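(* Let $p$ be a prime and let $A$ be a Henselian valuation ring which is not a field, with field of fractions $K$, maximal ideal $\mathfrak{m}_A$, residue field $k$ and valuation $v_A$, where $\operatorname{char}K=0$ and $\operatorname{char}k=p$. Assume $K$ contains a primitive $p$-th root of unity $\zeta$; put $\mathfrak{z}=\zeta-1$ and $e'=v_A(p)/(p-1)=v_A(\mathfrak{z})$. Let $L/K$ be a non-trivial Kummer extension of degree $p$. The following are equivalent: (a) A best $h$ for $L/K$ exists. (b) There exists $h\in A$ generating $L/K$ that satisfies exactly one of the following properties, where $s,t\in\mathfrak{m}_A$, $u,c\in A^\times$ and the residue class $\bar u$ of $u$ is not in $k^p$: (i) $p\nmid v_A(h)$; (ii) $h=u$; (iii) $h=1+ct$ with $0<v_A(t)<e'p$ and $p\nmid v_A(t)$; (iv) $h=1+us^p$ with $0<v_A(s)<e'$; (v) $h=1+c\mathfrak{z}^p$ with $\bar c\notin\{x^p-x\mid x\in k\}$. (c) The extension $L/K$ is defectless.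
   Context: An element $h\in K$ generates $L/K$ if $L=K(\alpha)$ with $\alpha^p=h$. If $h,h'$ both generate $L/K$ then $h'=h^ig^p$ for some $g\in K^\times$ and $1\le i\le p-1$. A generator $h$ is called best if $v_A(h-1)=\sup_{g\in K^\times,\,1\le i\le p-1}v_A(h^ig^p-1)$ (equivalently $v_A(\mathfrak{z}^p/(h-1))=\inf_{g,i}v_A(\mathfrak{z}^p/(h^ig^p-1))$). Since $A$ is Henselian, $v_A$ extends uniquely to $L$, with value group $\Gamma_B$ and residue field $l$; with $e_{L/K}=[\Gamma_B:v_A(K^\times)]$ and $f_{L/K}=[l:k]$, the defect $d_{L/K}$ is defined by $[L:K]=d_{L/K}e_{L/K}f_{L/K}$, and $L/K$ is defectless if $d_{L/K}=1$. *)

(* Defs.v *)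
From HB Require Import structures.
From mathcomp Require Import all_boot all_order all_algebra all_field.
Set Implicit Arguments. Unset Strict Implicit. Unset Printing Implicit Defensive.
Import Order.TTheory GRing.Theory Num.Theory.
Local Open Scope ring_scope.

Section Val.
Variables (F : fieldType) (R : pred F).

Definition is_valring : Prop :=
  [/\ 0 \in R, 1 \in R,
      (forall x y, x \in R -> y \in R -> x - y \in R),
      (forall x y, x \in R -> y \in R -> x * y \in R) &
      (forall x : F, x != 0 -> x \in R \/ x^-1 \in R)].

Definition vunit (x : F) : Prop := x \in R /\ x != 0 /\ x^-1 \in R.
Definition maxid (x : F) : Prop := x \in R /\ ~ vunit x.

(* v_R(x) <= v_R(y) *)
Definition vle (x y : F) : Prop := exists2 a, a \in R & y = a * x.
Definition vlt (x y : F) : Prop := vle x y /\ ~ vle y x.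
Definition veq (x y : F) : Prop := vle x y /\ vle y x.

Definition henselian : Prop :=
  forall f : {poly F}, f \is monic -> (forall i, f`_i \in R) ->
  forall a, a \in R -> maxid f.[a] -> vunit (f^`()).[a] ->
  exists b, [/\ b \in R, root f b & maxid (b - a)].

(* p divides v_R(x) in the value group, for x != 0 *)
Definition pdivv (p : nat) (x : F) : Prop :=
  exists g : F, g != 0 /\ veq x (g ^+ p).
End Val.

Definition res_ppow (K : fieldType) (A : pred K) (p : nat) (u : K) : Prop :=
  exists2 x, x \in A & maxid A (u - x ^+ p).
Definition res_AS (K : fieldType) (A : pred K) (p : nat) (c : K) : Prop :=
  exists2 x, x \in A & maxid A (c - (x ^+ p - x)).

Definition generates (K : fieldType) (L : fieldExtType K) (p : nat) (h : K) : Prop :=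
  exists alpha : L, alpha ^+ p = h%:A /\ (<<1; alpha>>)%VS = fullv.

Definition best (K : fieldType) (L : fieldExtType K) (A : pred K) (p : nat) (h : K) : Prop :=
  generates L p h /\
  forall (g : K) (i : nat), g != 0 -> (1 <= i <= p.-1)%N ->
    vle A (h ^+ i * g ^+ p - 1) (h - 1).

Fixpoint none_holds (l : seq Prop) : Prop :=
  match l with
  | [::] => True
  | P :: l' => ~ P /\ none_holds l'
  end.
Fixpoint exactly_one (l : seq Prop) : Prop :=
  match l with
  | [::] => False
  | P :: l' => (P /\ none_holds l') \/ (~ P /\ exactly_one l')
  end.

Section Props.
Variables (K : fieldType) (A : pred K) (p : nat) (z : K) (h : K).
Definition prop_i : Prop := ~ pdivv A p h.
Definition prop_ii : Prop := vunit A h /\ ~ res_ppow A p h.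
Definition prop_iii : Prop := exists c t, [/\ vunit A c, maxid A t, h = 1 + c * t,
  vlt A t (z ^+ p) & ~ pdivv A p t].
Definition prop_iv : Prop := exists u s, [/\ vunit A u, ~ res_ppow A p u, maxid A s,
  h = 1 + u * s ^+ p & vlt A s z].
Definition prop_v : Prop := exists c, [/\ vunit A c, h = 1 + c * z ^+ p & ~ res_AS A p c].
End Props.

(* Ramification index e_{L/K} = n w.r.t. the valuation ring B of L:
   [Gamma_B : v(K^x)] = n, i.e. L^x / (K^x B^x) has exactly n elements. *)
Definition ram_index (K : fieldType) (L : fieldExtType K) (B : pred L) (n : nat) : Prop :=
  let equiv (x y : L) := exists2 a : K, a != 0 & veq B x (a%:A * y) in
  exists x : 'I_n -> L,
    [/\ (forall i, x i != 0),
        (forall i j, equiv (x i) (x j) -> i = j) &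
        (forall y, y != 0 -> exists i, equiv y (x i))].

(* Residue degree f_{L/K} = n: [l : k] = n, witnessed by a k-basis of l
   given by residues of b_0..b_{n-1} in B. *)
Definition res_degree (K : fieldType) (L : fieldExtType K) (A : pred K) (B : pred L)
    (n : nat) : Prop :=
  exists b : 'I_n -> L,
    [/\ (forall i, b i \in B),
        (forall c : 'I_n -> K, (forall i, c i \in A) ->
           maxid B (\sum_i (c i)%:A * b i) -> forall i, maxid A (c i)) &
        (forall y, y \in B -> exists2 c : 'I_n -> K, (forall i, c i \in A) &
           maxid B (y - \sum_i (c i)%:A * b i))].

Definition extends_val (K : fieldType) (L : fieldExtType K) (A : pred K) (B : pred L) : Prop :=
  is_valring B /\ forall x : K, (x%:A \in B) = (x \in A).

(* L/K defectless: [L:K] = e_{L/K} f_{L/K} for the (unique) extension B of A *)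
Definition defectless (K : fieldType) (L : fieldExtType K) (A : pred K) : Prop :=
  forall B : pred L, extends_val A B ->
  exists e f, [/\ ram_index B e, res_degree A B f & \dim {:L} = (e * f)%N].

(* Main.v *)
Require Import Defs.
From HB Require Import structures.
From mathcomp Require Import all_boot all_order all_algebra all_field.
From mathcomp Require Import ring zify.
From mathcomp Require Import boolp classical_sets.
Import Order.TTheory GRing.Theory Num.Theory.
Local Open Scope ring_scope.
Set Implicit Arguments. Unset Strict Implicit. Unset Printing Implicit Defensive.

(* Values are compared through the divisibility preorder of a valuation ring.
   Put w = 1 + r. If v(r) < v(z), then w^p - 1 ~ r^p; if r = x z with x integral,
   then w^p - 1 ~ z^p (x^p - x). Hence h = 1 + t can be improved to some h^i g^p
   closer to 1 exactly when t is a p-th power to first order (v(t) < v(z^p)) or t / z^p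
   is of the form x^p - x in k (v(t) = v(z^p)), and v(t) > v(z^p) is excluded by Hensel's
   lemma; this gives (a) <-> (b).
   (b) -> (c): the normal form yields gamma in L (one of alpha, alpha - 1,
   (alpha - 1) / s, (alpha - 1) / z with alpha^p = h) such that either v(gamma^p) is
   not in p Gamma_A, or the residue of gamma has degree p over k; in both cases the powers
   of gamma form a valuation basis of L, for any extension B of A.
   (c) -> (a): some extension B exists (Chevalley, by Zorn's lemma), and ef = [L:K]
   provides a valuation basis of L, so that v(alpha - c) attains its maximum at some c in
   K; then h / c^p is best unless h already reduces to a normal form (i) or (ii). *)

(** * Valuation preorders *)

(** The value group has arbitrary rank, so iterated improvements of a generator need neither
    terminate nor converge: the supremum has to be attained by a finite argument, which the
    finiteness of a valuation basis supplies. Competitors h^i g^p also carry an exponent i. As 0 < i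
    < p, the integer i is a unit of A and its residue satisfies i^p = i; hence (1 + t)^i is 1 + i t
    to first order, and the factor i can be divided out both of a p-th power and of an expression
    x^p - x in k. The threshold z^p comes from (1 + z)^p = 1, which gives p z = - z^p to first
    order. When v(r) < v(z) all middle binomial terms of (1 + r)^p are negligible; when r = x z the
    linear one joins the p-th power, whence the Artin-Schreier polynomial. Henselianity enters
    through one bound, v(h - 1) <= v(z^p) for every generator h. *)

(* [vleb R x y] decides [v(x) <= v(y)], with [v(0) = oo]. *)
Definition vleb (F : fieldType) (R : pred F) (x y : F) : bool :=
  (y == 0) || (x != 0) && (y / x \in R).

Section Valuation.
Variables (F : fieldType) (R : pred F).
Hypothesis hR : is_valring R.
Local Notation "x <=v y" := (vleb R x y) (at level 70).
Local Notation "x <v y" := (~~ vleb R y x) (at level 70).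
Implicit Types x y z : F.

Let R0 : 0 \in R. Proof. by case: hR. Qed.
Let RB x y : x \in R -> y \in R -> x - y \in R.
Proof. by case: hR => _ _ + _ _; apply. Qed.
Let RM x y : x \in R -> y \in R -> x * y \in R.
Proof. by case: hR => _ _ _ + _; apply. Qed.
Let RN x : x \in R -> - x \in R.
Proof. by move=> hx; rewrite -sub0r; apply: RB. Qed.

Lemma vleP x y : reflect (vle R x y) (x <=v y).
Proof.
rewrite /vleb; apply: (iffP idP) => [/orP[/eqP->|/andP[x0 h]]|[a ha ->]].
- by exists 0; rewrite ?mul0r.
- by exists (y / x); rewrite ?divfK.
- have [->|x0] := eqVneq x 0; first by rewrite mulr0 eqxx.
  by rewrite mulfK // ha orbT.
Qed.

Lemma vleb_total x y : (x <=v y) || (y <=v x).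
Proof.
rewrite /vleb; have [->|x0] := eqVneq x 0; first by rewrite orbT.
have [->//|y0] := eqVneq y 0; rewrite /=.
case: hR => _ _ _ _ /(_ (y / x)); rewrite mulf_neq0 ?invr_eq0 // invf_div.
by case=> // ->; rewrite ?orbT.
Qed.

Lemma vltW x y : x <v y -> x <=v y.
Proof. by move=> h; have := vleb_total x y; rewrite (negPf h) orbF. Qed.

Lemma vltP x y : reflect (vlt R x y) (x <v y).
Proof.
apply: (iffP idP) => [h|[_ h]]; last by apply/negP => /vleP.
by split; [apply/vleP/vltW | move=> /vleP; apply/negP].
Qed.

Lemma vleb_refl x : x <=v x.
Proof. by rewrite /vleb; have [//|x0] := eqVneq x 0; rewrite divff //; case: hR. Qed.

Lemma vleb_trans y x z : x <=v y -> y <=v z -> x <=v z.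
Proof.
move=> /vleP[a ha ->] /vleP[b hb ->]; apply/vleP; exists (b * a); first exact: RM.
by rewrite mulrA.
Qed.

Lemma vle_lt_trans y x z : x <=v y -> y <v z -> x <v z.
Proof. by move=> xy; apply: contra => zx; apply: vleb_trans xy. Qed.

Lemma vlt_le_trans y x z : x <v y -> y <=v z -> x <v z.
Proof. by move=> xy yz; apply: contra xy => zx; apply: vleb_trans zx. Qed.

Lemma vlt_trans y x z : x <v y -> y <v z -> x <v z.
Proof. by move=> /vltW; apply: vle_lt_trans. Qed.

Lemma vleb0 x : x <=v 0.
Proof. by rewrite /vleb eqxx. Qed.

Lemma vle0b x : (0 <=v x) = (x == 0).
Proof. by rewrite /vleb eqxx orbF. Qed.

Lemma vltb0 x : (x <v 0) = (x != 0).
Proof. by rewrite vle0b. Qed.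

Lemma vlt_neq0 x y : x <v y -> x != 0.
Proof. by apply: contraNneq => ->; apply: vleb0. Qed.

Lemma vle1b x : (1 <=v x) = (x \in R).
Proof. by rewrite /vleb oner_eq0 divr1 /=; case: eqP => // ->; rewrite R0. Qed.

Lemma vleb_mull a x y : a != 0 -> (a * x <=v a * y) = (x <=v y).
Proof. by move=> a0; rewrite /vleb !mulf_eq0 (negPf a0) /= -mulf_div divff ?mul1r. Qed.

Lemma vleb_mulr a x y : a != 0 -> (x * a <=v y * a) = (x <=v y).
Proof. by rewrite ![_ * a]mulrC; apply: vleb_mull. Qed.

Lemma vleb_mul x y x' y' : x <=v y -> x' <=v y' -> x * x' <=v y * y'.
Proof.
move=> /vleP[a ha ->] /vleP[b hb ->]; apply/vleP; exists (a * b); first exact: RM.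
by rewrite mulrACA.
Qed.

Lemma vlt_le_mul x y x' y' : x <v y -> x' <=v y' -> x' != 0 -> x * x' <v y * y'.
Proof.
move=> xy xy' x0; apply: (@vlt_le_trans (y * x')); first by rewrite vleb_mulr.
by apply: vleb_mul => //; apply: vleb_refl.
Qed.

Lemma vlt_mul x y x' y' : x <v y -> x' <v y' -> x * x' <v y * y'.
Proof. by move=> xy xy'; apply: vlt_le_mul => //; [apply: vltW | apply: vlt_neq0 xy']. Qed.

Lemma vlebN x y : (x <=v - y) = (x <=v y).
Proof.
by rewrite /vleb oppr_eq0 mulNr; congr (_ || _ && _); apply/idP/idP => /RN; rewrite ?opprK.
Qed.

Lemma vleNb x y : (- x <=v y) = (x <=v y).
Proof.
rewrite /vleb oppr_eq0 invrN mulrN; congr (_ || _ && _).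
by apply/idP/idP => /RN; rewrite ?opprK.
Qed.

Lemma vlebB x y : (x <=v y) -> forall z, x <=v z -> x <=v y - z.
Proof.
move=> /vleP[a ha ->] z /vleP[b hb ->]; apply/vleP; exists (a - b); first exact: RB.
by rewrite mulrBl.
Qed.

Lemma vlebD x y z : x <=v y -> x <=v z -> x <=v y + z.
Proof. by move=> xy; rewrite -vlebN -{2}[z]opprK; apply: vlebB. Qed.

Lemma vltbD x y z : x <v y -> x <v z -> x <v y + z.
Proof.
move=> xy xz; case/orP: (vleb_total y z) => yz.
  by apply: vlt_le_trans xy _; apply: vlebD => //; apply: vleb_refl.
by apply: vlt_le_trans xz _; apply: vlebD => //; apply: vleb_refl.
Qed.

Lemma vltbB x y z : x <v y -> x <v z -> x <v y - z.
Proof. by move=> xy xz; apply: vltbD => //; rewrite vleNb. Qed.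

Lemma vleb_sum x I (r : seq I) (P : pred I) (G : I -> F) :
  (forall i, P i -> x <=v G i) -> x <=v \sum_(i <- r | P i) G i.
Proof. by move=> h; apply: (big_ind (fun y => x <=v y)) => //; [apply: vleb0 | apply: vlebD]. Qed.

Lemma vltb_sum x I (r : seq I) (P : pred I) (G : I -> F) : x != 0 ->
  (forall i, P i -> x <v G i) -> x <v \sum_(i <- r | P i) G i.
Proof.
by move=> x0 h; apply: (big_ind (fun y => x <v y)) => //; [rewrite vltb0 | move=> ? ?; apply: vltbD].
Qed.

(** If v(x + y) exceeded v(x), so would the value of x = (x + y) - y. The equality v(x + y) = v(x)
    is given as two rewriting rules because no value group is formed. *)
Lemma vle_addr_dom x y : x <v y ->
  (forall w, (w <=v x + y) = (w <=v x)) * (forall w, (x + y <=v w) = (x <=v w)).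
Proof.
move=> xy; have h1 : x <=v x + y by apply: vlebD; [apply: vleb_refl | apply: vltW].
have h2 : x + y <=v x.
  case/orP: (vleb_total x (x + y)) => // h; apply: contraT => h3.
  by have := vltbB h3 xy; rewrite addrK vleb_refl.
by split=> w; apply/idP/idP => h; [apply: vleb_trans h h2|apply: vleb_trans h h1|
  apply: vleb_trans h1 h|apply: vleb_trans h2 h].
Qed.

(* The form in which domination is used: [w - x] is negligible against [x]. *)
Lemma vle_dom x w : x <v w - x -> (forall y, (y <=v w) = (y <=v x)) * (forall y, (w <=v y) = (x <=v y)).
Proof. by move=> /vle_addr_dom; rewrite subrKC. Qed.

Lemma vleb_exp x y n : x <=v y -> x ^+ n <=v y ^+ n.
Proof.
by move=> xy; elim: n => [|n IH]; rewrite ?vleb_refl // !exprS; apply: vleb_mul.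
Qed.

Lemma vltb_exp x y n : (0 < n)%N -> x <v y -> x ^+ n <v y ^+ n.
Proof.
case: n => // n _ xy; elim: n => [|n IH]; first by rewrite !expr1.
by rewrite !(exprS _ n.+1); apply: vlt_mul.
Qed.

Lemma vle_pexp x y n : (0 < n)%N -> (x ^+ n <=v y ^+ n) = (x <=v y).
Proof.
move=> n0; apply/idP/idP; last exact: vleb_exp.
by apply: contraTT; apply: vltb_exp.
Qed.

Lemma vle1_exp x n : (0 < n)%N -> (1 <=v x ^+ n) = (1 <=v x).
Proof. by move=> n0; rewrite -{1}(expr1n F n) vle_pexp. Qed.

Lemma vlex1_exp x n : (0 < n)%N -> (x ^+ n <=v 1) = (x <=v 1).
Proof. by move=> n0; rewrite -{1}(expr1n F n) vle_pexp. Qed.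

Lemma vlex1V x : x != 0 -> (x <=v 1) = (x^-1 \in R).
Proof. by move=> x0; rewrite /vleb oner_eq0 x0 mul1r. Qed.

Lemma vle_div x y z : z != 0 -> (x <=v y / z) = (x * z <=v y).
Proof. by move=> z0; rewrite -(vleb_mulr _ _ z0) divfK. Qed.

Lemma vle_divl x y z : z != 0 -> (x / z <=v y) = (x <=v y * z).
Proof. by move=> z0; rewrite -(vleb_mulr _ _ z0) divfK. Qed.

Lemma vunitP x : reflect (vunit R x) ((1 <=v x) && (x <=v 1)).
Proof.
apply: (iffP andP) => [[h1 h2]|[h1 [h2 h3]]]; last by rewrite vle1b vlex1V.
have x0 : x != 0 by apply: contraTneq h2 => ->; rewrite vle0b oner_eq0.
by split; [rewrite -vle1b | split; rewrite -?vlex1V].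
Qed.

Lemma maxidP x : reflect (maxid R x) (1 <v x).
Proof.
apply: (iffP idP) => [h|[h1 h2]].
  split; first by rewrite -vle1b vltW.
  by move/vunitP; rewrite (negPf h) andbF.
by apply/negP => h; apply: h2; apply/vunitP; rewrite vle1b h1.
Qed.

Lemma veqP x y : reflect (veq R x y) ((x <=v y) && (y <=v x)).
Proof. by apply: (iffP andP) => -[/vleP ? /vleP]. Qed.

Lemma vle_nat x n : 1 <=v x -> 1 <=v x *+ n.
Proof. by move=> hx; elim: n => [|n IH]; rewrite ?mulr0n ?vleb0 // mulrS vlebD. Qed.

Lemma vle1M x y : 1 <=v x -> 1 <=v y -> 1 <=v x * y.
Proof. by move=> hx hy; have := vleb_mul hx hy; rewrite mulr1. Qed.

Lemma vlt1M x y : 1 <v x -> 1 <=v y -> 1 <v x * y.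
Proof. by move=> hx hy; have := vlt_le_mul hx hy (oner_neq0 F); rewrite mulr1. Qed.

Lemma vle1X x n : 1 <=v x -> 1 <=v x ^+ n.
Proof. by move=> /(vleb_exp n); rewrite expr1n. Qed.

Lemma vlex1X x n : x <=v 1 -> x ^+ n <=v 1.
Proof. by move=> /(vleb_exp n); rewrite expr1n. Qed.

Lemma vlt_mul1 x y z : x <v y -> 1 <=v z -> x <v y * z.
Proof. by move=> hx hy; have := vlt_le_mul hx hy (oner_neq0 F); rewrite mulr1. Qed.

Lemma vle_mul1 x y z : x <=v y -> 1 <=v z -> x <=v y * z.
Proof. by move=> hx hy; have := vleb_mul hx hy; rewrite mulr1. Qed.

Lemma vleV x y : x != 0 -> y != 0 -> (x^-1 <=v y^-1) = (y <=v x).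
Proof. by move=> x0 y0; rewrite /vleb !invr_eq0 (negPf x0) (negPf y0) /= invrK mulrC. Qed.

Lemma vle1V x : x != 0 -> (1 <=v x^-1) = (x <=v 1).
Proof. by move=> x0; rewrite -[X in vleb _ X]invr1 vleV ?oner_eq0. Qed.

Lemma vle_min (I : eqType) (s : seq I) (G : I -> F) : s != [::] ->
  exists2 k, k \in s & forall j, j \in s -> G k <=v G j.
Proof.
elim: s => // i [|i' s] IH _.
  by exists i; rewrite ?inE // => j; rewrite inE => /eqP->; apply: vleb_refl.
have [//|k ks hk] := IH; case/orP: (vleb_total (G i) (G k)) => h.
  exists i; rewrite ?inE ?eqxx // => j; rewrite inE => /orP[/eqP->|/hk]; first exact: vleb_refl.
  exact: vleb_trans.
exists k; first by rewrite inE ks orbT.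
by move=> j; rewrite inE => /orP[/eqP->|/hk].
Qed.

Lemma vle_max (I : eqType) (s : seq I) (G : I -> F) : s != [::] ->
  exists2 k, k \in s & forall j, j \in s -> G j <=v G k.
Proof.
elim: s => // i [|i' s] IH _.
  by exists i; rewrite ?inE // => j; rewrite inE => /eqP->; apply: vleb_refl.
have [//|k ks hk] := IH; case/orP: (vleb_total (G i) (G k)) => h.
  exists k; first by rewrite inE ks orbT.
  by move=> j; rewrite inE => /orP[/eqP->|/hk].
exists i; rewrite ?inE ?eqxx // => j; rewrite inE => /orP[/eqP->|/hk]; first exact: vleb_refl.
by move=> hj; apply: vleb_trans hj h.
Qed.

(* Distinct values: no cancellation can occur. *)
Lemma vle_sum_distinct (I : finType) (y : I -> F) :
  (forall i j, y i != 0 -> y i <=v y j -> y j <=v y i -> i = j) ->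
  forall k, \sum_i y i <=v y k.
Proof.
move=> hy k; have [|k0 _ hk0] := @vle_min I (enum I) y.
  by apply/eqP => h; have := mem_enum I k; rewrite h.
have {}hk0 j : y k0 <=v y j by apply: hk0; rewrite mem_enum.
have [y0|y0] := eqVneq (y k0) 0.
  rewrite big1 => [|i _]; last by apply/eqP; rewrite -vle0b -y0.
  by have := hk0 k; rewrite y0.
rewrite (bigD1 k0) //= vle_addr_dom //; apply: vltb_sum => // i ne.
by apply: contra ne => h; apply/eqP/esym/hy.
Qed.

End Valuation.

(** * Residue fields *)

Section ResidueField.
Variables (F : fieldType) (R : pred F) (hR : is_valring R).
Local Notation "x <=v y" := (vleb R x y) (at level 70).
Local Notation "x <v y" := (~~ vleb R y x) (at level 70).

(** The value of [choose] depends only on the predicate once it is inhabited, so congruent elements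
    receive the same representative and no quotient type is formed. *)
Definition res_repr (x : F) : F := choose [pred y | 1 <v y - x] x.

Lemma res_reprP x : 1 <v res_repr x - x.
Proof. by apply: (@chooseP _ [pred y | 1 <v y - x]); rewrite /= subrr vltb0 ?oner_eq0. Qed.

Lemma eq_res_repr x y : 1 <v x - y -> res_repr x = res_repr y.
Proof.
move=> xy; rewrite /res_repr (@eq_choose _ _ [pred w | 1 <v w - y]) => [|w /=].
  by apply: choose_id => /=; rewrite ?subrr ?vltb0 ?oner_eq0.
apply/idP/idP => h.
  by rewrite -[w - y](subrKA x) vltbD.
by rewrite -[w - x](subrKA y) vltbD // -opprB vleNb.
Qed.

Lemma res_repr_id x : res_repr (res_repr x) = res_repr x.
Proof. by apply: eq_res_repr; apply: res_reprP. Qed.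

Lemma vle1_res_repr x : 1 <=v x -> 1 <=v res_repr x.
Proof. by move=> hx; rewrite -[res_repr x](subrK x) vlebD // vltW // res_reprP. Qed.

(* The residue field, carried by a system of canonical representatives. *)
Definition residue (_ : is_valring R) : Type := {x : F | (1 <=v x) && (res_repr x == x)}.
Local Notation k := (residue hR).
HB.instance Definition _ := SubChoice.on k.

(** Elements outside the ring get the class of 0 as a default, which makes [res] total. *)
Lemma res_subproof x : let y := if 1 <=v x then res_repr x else res_repr 0 in
  (1 <=v y) && (res_repr y == y).
Proof.
by move=> /=; case: ifP => hx; rewrite res_repr_id eqxx andbT vle1_res_repr ?vleb0.
Qed.

Definition res (x : F) : k :=
  exist (fun y => is_true ((1 <=v y) && (res_repr y == y))) _ (res_subproof x).

Lemma val_res x : 1 <=v x -> val (res x) = res_repr x.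
Proof. by rewrite /res /= => ->. Qed.

Lemma resE x y : 1 <=v x -> 1 <=v y -> (res x = res y) <-> (1 <v x - y).
Proof.
move=> hx hy; split=> [/(congr1 val)|h]; last first.
  by apply: val_inj; rewrite !val_res //; apply: eq_res_repr.
rewrite !val_res // => e; have := vltbB hR (res_reprP y) (res_reprP x).
by rewrite e opprB addrC addrA subrK.
Qed.

Lemma res_val (a : k) : res (val a) = a.
Proof. by apply: val_inj; case: a => x /= /andP[hx /eqP e]; rewrite hx. Qed.

Lemma vle1_val (a : k) : 1 <=v val a.
Proof. by case: a => x /= /andP[]. Qed.

Lemma res_surj (a : k) : exists2 x, 1 <=v x & a = res x.
Proof. by exists (val a); [apply: vle1_val | rewrite res_val]. Qed.

Lemma val_res_sub x : 1 <=v x -> 1 <v val (res x) - x.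
Proof. by move=> hx; rewrite val_res // res_reprP. Qed.

Let add (a b : k) := res (val a + val b).
Let opp (a : k) := res (- val a).
Let mul (a b : k) := res (val a * val b).
Let inv (a : k) := if a == res 0 then a else res (val a)^-1.

Let addE x y : 1 <=v x -> 1 <=v y -> add (res x) (res y) = res (x + y).
Proof.
move=> hx hy; apply/resE; rewrite ?vlebD ?vle1_val //.
by rewrite opprD addrACA vltbD ?val_res_sub.
Qed.

Let oppE x : 1 <=v x -> opp (res x) = res (- x).
Proof.
move=> hx; apply/resE; rewrite ?vlebN ?vle1_val //.
by rewrite -opprD vleNb ?val_res_sub.
Qed.

Let mulE x y : 1 <=v x -> 1 <=v y -> mul (res x) (res y) = res (x * y).
Proof.
move=> hx hy; apply/resE; rewrite ?vle1M ?vle1_val //.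
have -> : val (res x) * val (res y) - x * y =
  (val (res x) - x) * val (res y) + (val (res y) - y) * x by ring.
by rewrite vltbD // vlt1M ?vle1_val ?val_res_sub.
Qed.

Local Ltac reselim := repeat
  (let x := fresh "x" in let hx := fresh "h" in move=> /res_surj[x hx ->]).
Local Ltac vle1 := by rewrite ?(vlebD, vle1M, vlebN, vleb_refl, vleb0).

Fact res_addA : associative add.
Proof. by reselim; rewrite !addE ?addrA //; vle1. Qed.
Fact res_addC : commutative add.
Proof. by move=> a b; rewrite /add addrC. Qed.
Fact res_add0 : left_id (res 0) add.
Proof. by reselim; rewrite !addE ?add0r //; vle1. Qed.
Fact res_addN : left_inverse (res 0) opp add.
Proof. by reselim; rewrite oppE ?addE ?addNr //; vle1. Qed.
HB.instance Definition _ := GRing.isZmodule.Build k res_addA res_addC res_add0 res_addN.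

Fact res_mulA : associative mul.
Proof. by reselim; rewrite !mulE ?mulrA //; vle1. Qed.
Fact res_mulC : commutative mul.
Proof. by move=> a b; rewrite /mul mulrC. Qed.
Fact res_mul1 : left_id (res 1) mul.
Proof. by reselim; rewrite !mulE ?mul1r //; vle1. Qed.
Fact res_mulD : left_distributive mul add.
Proof. by reselim; rewrite !(addE, mulE) ?mulrDl //; vle1. Qed.
Fact res_1neq0 : res 1 != res 0.
Proof.
apply/eqP => /(resE (vleb_refl hR 1) (vleb0 R 1)).
by rewrite subr0 vleb_refl.
Qed.
HB.instance Definition _ :=
  GRing.Zmodule_isComNzRing.Build k res_mulA res_mulC res_mul1 res_mulD res_1neq0.

Fact res_mulV (a : k) : a != 0 -> inv a * a = 1.
Proof.
rewrite /inv => a0; rewrite -[0]/(res 0) in a0; rewrite (negPf a0).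
case: (res_surj a) a0 => x hx -> nz.
have hx1 : val (res x) <=v 1.
  apply: contraNT nz => h; apply/eqP/resE; rewrite ?vleb0 // subr0.
  by rewrite -[x](subKr (val (res x))) vltbB // val_res_sub.
have x0 : val (res x) != 0 by apply: contraTneq hx1 => ->; rewrite vle0b oner_eq0.
rewrite -[X in _ * X = _](res_val (res x)) -[LHS]/(mul _ _) mulE ?mulVf ?vle1_val //.
by rewrite vle1V.
Qed.
Fact res_inv0 : inv 0 = 0.
Proof. by rewrite /inv eqxx. Qed.
HB.instance Definition _ := GRing.ComNzRing_isField.Build k res_mulV res_inv0.

Lemma resD x y : 1 <=v x -> 1 <=v y -> res (x + y) = res x + res y.
Proof. by move=> hx hy; rewrite -addE. Qed.

Lemma resN x : 1 <=v x -> res (- x) = - res x.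
Proof. by move=> hx; rewrite -oppE. Qed.

Lemma resB x y : 1 <=v x -> 1 <=v y -> res (x - y) = res x - res y.
Proof. by move=> hx hy; rewrite resD ?resN ?vlebN. Qed.

Lemma resM x y : 1 <=v x -> 1 <=v y -> res (x * y) = res x * res y.
Proof. by move=> hx hy; rewrite -mulE. Qed.

Lemma res0 : res 0 = 0. Proof. by []. Qed.
Lemma res1 : res 1 = 1. Proof. by []. Qed.

Lemma res_eq0 x : 1 <=v x -> (res x == 0) = (1 <v x).
Proof.
move=> hx; apply/eqP/idP; rewrite -res0.
  by move/(resE hx (vleb0 R 1)); rewrite subr0.
by move=> h; apply/(resE hx (vleb0 R 1)); rewrite subr0.
Qed.

Lemma resX x n : 1 <=v x -> res (x ^+ n) = res x ^+ n.
Proof. by move=> hx; elim: n => // n IH; rewrite !exprS resM ?IH // vle1X. Qed.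

Lemma res_nat n : res n%:R = n%:R.
Proof.
by elim: n => // n IH; rewrite !mulrS resD ?IH ?res1 // ?vleb_refl // vle_nat ?vleb_refl.
Qed.

Lemma res_sum I (r : seq I) (P : pred I) (G : I -> F) : (forall i, 1 <=v G i) ->
  res (\sum_(i <- r | P i) G i) = \sum_(i <- r | P i) res (G i).
Proof.
move=> hG; elim: r => [|i r IH]; rewrite ?big_nil // !big_cons; case: ifP => // _.
by rewrite resD ?IH // vleb_sum.
Qed.

Lemma res_pchar p : prime p -> 1 <v p%:R -> p \in [pchar k].
Proof.
by move=> pp hp; rewrite inE pp -res_nat res_eq0 // vltW.
Qed.

End ResidueField.

(** * Irreducibility of X^p - c and X^p - X - c in characteristic p *)

Section Irreducibility.
Variables (k l : fieldType) (phi : {rmorphism k -> l}) (p : nat).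
Hypothesis pcharl : p \in [pchar l].

Lemma pchar_natf_inj i j : (i < p)%N -> (j < p)%N -> i%:R = j%:R :> l -> i = j.
Proof.
wlog le_ij : i j / (i <= j)%N => [H hi hj e|_ hj e].
  by case/orP: (leq_total i j) => h; [apply: H | apply/esym/H].
have : (j - i)%:R == 0 :> l by rewrite natrB // e subrr.
rewrite -(dvdn_pcharf pcharl) => d; apply/eqP; rewrite eqn_leq le_ij /=.
rewrite -subn_eq0; apply: contraTT d => ne; rewrite gtnNdvd ?lt0n //.
by rewrite (leq_ltn_trans (leq_subr _ _)).
Qed.

(** The boolean [eps] treats both residue polynomials at once. For [eps = true], additivity of
    Frobenius makes the p translates of g by the prime field distinct roots of X^p - X - c; for
    [eps = false] they all coincide with g, in accordance with X^p - g^p = (X - g)^p. *)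
Lemma prod_root_translates (eps : bool) (c g : l) : g ^+ p - eps%:R * g = c ->
  'X^p - eps%:R *: 'X - c%:P =
  \prod_(j <- iota 0 p) ('X - (g + eps%:R * j%:R)%:P) :> {poly l}.
Proof.
have pp := pcharf_prime pcharl; have p1 := prime_gt1 pp.
have FB (R : comNzRingType) (x y : R) : p \in [pchar R] -> (x - y) ^+ p = x ^+ p - y ^+ p.
  by move=> h; rewrite -!(pFrobenius_autE h) pFrobenius_autB_comm //; apply: mulrC.
have FD (x y : l) : (x + y) ^+ p = x ^+ p + y ^+ p.
  by rewrite -!(pFrobenius_autE pcharl) pFrobenius_autD_comm //; apply: mulrC.
have Fn j : (j%:R : l) ^+ p = j%:R by rewrite -(pFrobenius_autE pcharl) pFrobenius_aut_nat.
case: eps => /= [hg|].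
  pose rs := [seq g + j%:R | j <- iota 0 p].
  have sf : size ('X^p - 1 *: 'X - c%:P : {poly l}) = p.+1.
    rewrite -addrA size_polyDl size_polyXn // ltnS scale1r.
    rewrite -opprD size_polyN (leq_trans (size_polyD _ _)) //.
    by rewrite geq_max size_polyX p1 (leq_trans (size_polyC_leq1 _)) // ltnW.
  rewrite (all_roots_prod_XsubC (p := 'X^p - 1 *: 'X - c%:P) (rs := rs)).
  - have -> : lead_coef ('X^p - 1 *: 'X - c%:P : {poly l}) = 1.
      rewrite /lead_coef sf /= !coefE eqxx mul1r.
      by rewrite (gtn_eqF p1) (gtn_eqF (prime_gt0 pp)) !subr0.
    by rewrite scale1r big_map; apply: eq_bigr => j _; rewrite mul1r.
  - by rewrite size_map size_iota.
  - apply/allP => _ /mapP[j _ ->]; rewrite /root !hornerE FD Fn -hg.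
    by apply/eqP; ring.
  rewrite uniq_rootsE map_inj_in_uniq ?iota_uniq // => i j.
  rewrite !mem_iota !add0n => /andP[_ hi] /andP[_ hj] /addrI.
  exact: pchar_natf_inj.
rewrite mul0r subr0 => <-; under eq_bigr => j _ do rewrite mul0r addr0.
rewrite big_const_seq count_predT size_iota iter_mulr_1 FB ?(rmorph_pchar polyC) //.
by rewrite scale0r subr0 polyC_exp.
Qed.

(* If gcd(g, f) is a proper factor of f = X^p - eps X - c, it is a product of
   n < p of the factors X - (gamma + eps j); its subleading coefficient is then
   -(n gamma + eps m), so that gamma would already lie in k. *)
Lemma root_translates_free (eps : bool) (c : k) (gamma : l) (g : {poly k}) :
  gamma ^+ p - eps%:R * gamma = phi c ->
  (forall x : k, x ^+ p - eps%:R * x != c) ->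
  (size g <= p)%N -> root (map_poly phi g) gamma -> g = 0.
Proof.
move=> hgamma hc sg rg; apply: contraTeq isT => g0.
have pp := pcharf_prime pcharl.
pose f : {poly k} := 'X^p - eps%:R *: 'X - c%:P.
have mf0 : map_poly phi f = 'X^p - eps%:R *: 'X - (phi c)%:P.
  rewrite /f !rmorphB /= map_polyZ map_polyXn map_polyX.
  by rewrite map_polyC rmorph_nat.
have mf := etrans mf0 (prod_root_translates hgamma).
pose d := gcdp g f.
have d0 : d != 0 by rewrite gcdp_eq0 negb_and g0.
have rd : root (map_poly phi d) gamma.
  by rewrite gcdp_map root_gcd rg mf0 /root !hornerE hgamma subrr eqxx.
have sd1 : (1 < size d)%N.
  by rewrite -(size_map_poly phi); apply: root_size_gt1 rd; rewrite map_poly_eq0.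
have sd2 : (size d <= p)%N by apply: leq_trans sg; apply: leq_gcdpl.
have : map_poly phi d %| map_poly phi f by rewrite dvdp_map dvdp_gcdr.
rewrite mf => /dvdp_prod_XsubC[m]; set s := mask m _ => eqd.
pose rs := [seq gamma + eps%:R * j%:R | j <- s].
have {}eqd : map_poly phi d %= \prod_(x <- rs) ('X - x%:P) by rewrite big_map.
have szd : size d = (size rs).+1 by rewrite -(size_map_poly phi) (eqp_size eqd) size_prod_XsubC.
pose d' := (lead_coef d)^-1 *: d.
have md' : map_poly phi d' = \prod_(x <- rs) ('X - x%:P).
  apply/eqP; rewrite -eqp_monic ?monic_prod_XsubC //.
    by apply: eqp_trans eqd; rewrite eqp_map eqp_scale // invr_eq0 lead_coef_eq0.
  rewrite monicE lead_coef_map lead_coefZ mulVf ?rmorph1 // lead_coef_eq0 //.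
have rs0 : size rs != 0 by rewrite -lt0n -ltnS -szd.
have := coefPn_prod_XsubC rs0; rewrite -md' coef_map big_map big_split /= -mulr_sumr.
rewrite -natr_sum big_const_seq count_predT iter_addr_0 -(size_map (fun j => gamma + eps%:R * j%:R)) -/rs.
set n := size rs in rs0 szd *; set M := (\sum_(j <- s) j)%N; set e := d'`_ _ => He.
have n0 : (n%:R : k) != 0.
  rewrite -(fmorph_eq0 phi) rmorph_nat -(dvdn_pcharf pcharl) gtnNdvd ?lt0n //.
  by rewrite -ltnS -szd ltnS.
have gE : gamma = phi (- (e + eps%:R * M%:R) / n%:R).
  rewrite fmorph_div rmorphN rmorphD rmorphM !rmorph_nat He.
  apply: (canRL (mulfK _)); first by rewrite -(rmorph_nat phi) fmorph_eq0.
  by rewrite -mulr_natr; ring.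
have := hc (- (e + eps%:R * M%:R) / n%:R).
by rewrite -(fmorph_eq phi) rmorphB rmorphM rmorphXn rmorph_nat -gE hgamma eqxx.
Qed.
End Irreducibility.

(** * Valuations of p-th powers *)

(** The middle binomial coefficients are divisible by p; pulling p out leaves integral cofactors, so
    that the middle terms can be bounded through v(p). *)
Lemma exp1D_prime (F : comNzRingType) (p : nat) (x : F) : prime p ->
  (1 + x) ^+ p =
  1 + x ^+ p + p%:R * \sum_(i < p.-1) ('C(p, i.+1) %/ p)%:R * x ^+ i.+1.
Proof.
case: p => // p pp; rewrite exprDn big_ord_recl big_ord_recr /=.
rewrite subn0 bin0 expr0 /= /bump /= add1n binn subnn !expr1n !mulr1 !mulr1n mul1r.
rewrite -addrA; congr (_ + _); rewrite addrC; congr (_ + _).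
rewrite mulr_sumr; apply: eq_bigr => i _.
rewrite expr1n mul1r mulrA -natrM -mulr_natl; congr (_%:R * _).
by rewrite mulnC divnK // prime_dvd_bin //= ltnS.
Qed.

Section PthPowers.
Variables (F : fieldType) (R : pred F) (hR : is_valring R).
Local Notation "x <=v y" := (vleb R x y) (at level 70).
Local Notation "x <v y" := (~~ vleb R y x) (at level 70).

(** First-order expansion, applied to exponents prime to p, for which the linear term n x keeps the
    value of x. *)
Lemma exp1D_val (x : F) n : x != 0 -> 1 <v x -> x <v (1 + x) ^+ n - 1 - n%:R * x.
Proof.
move=> x0 hx; elim: n => [|n IH].
  by rewrite expr0 subrr mul0r subr0 vltb0.
have -> : (1 + x) ^+ n.+1 - 1 - n.+1%:R * x =
   ((1 + x) ^+ n - 1 - n%:R * x) * (1 + x) + x * (x * n%:R).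
  by rewrite exprS -natr1; ring.
have n1 : 1 <=v n%:R by rewrite vle_nat // vleb_refl.
apply: vltbD => //.
  by apply: vlt_mul1 => //; apply: vlebD; rewrite ?vleb_refl // vltW.
by rewrite -[X in _ <v X]mulrC -[x in vleb _ _ x]mul1r vleb_mulr // vlt1M.
Qed.

Variables (p : nat) (z : F).
Hypotheses (pp : prime p) (hp : 1 <v p%:R) (z0 : z != 0).
(** This relation, p z = - z^p to first order, stands for z = zeta - 1, so that the section applies
    over K to z and over L to its image. *)
Hypothesis hz : z ^+ p <v p%:R * z + z ^+ p.

Let p0 := prime_gt0 pp.
Let p1 := prime_gt1 pp.
Let zp0 : z ^+ p != 0. Proof. by rewrite expf_neq0. Qed.

Let pzE : (forall y, (y <=v p%:R * z) = (y <=v z ^+ p)) *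
  (forall y, (p%:R * z <=v y) = (z ^+ p <=v y)).
Proof.
have [h1 h2] := vle_addr_dom hR (x := - z ^+ p) (y := p%:R * z + z ^+ p) ltac:(by rewrite vlebN).
split=> y; first by have := h1 y; rewrite addrC addrK vlebN.
by have := h2 y; rewrite addrC addrK vleNb.
Qed.

(** Division by z turns v(p z) = v(z^p) into v(p) = (p - 1) v(z), the identity behind e'. *)
Let pE : (forall y, (y <=v p%:R) = (y <=v z ^+ p.-1)) *
  (forall y, (p%:R <=v y) = (z ^+ p.-1 <=v y)).
Proof.
by split=> y; rewrite -(vleb_mulr _ _ _ z0) -[RHS](vleb_mulr _ _ _ z0) pzE -exprSr prednK.
Qed.

Lemma val_z_gt0 : 1 <v z.
Proof.
by have := hp; rewrite pE -(vlex1_exp hR z (n := p.-1)) // -ltnS prednK.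
Qed.

(** For 0 < j < p the middle term p x^j is negligible against x^p because v(p) = (p - 1) v(z)
    exceeds (p - j) v(x). If v(x) >= 0, this follows from (p - j) v(x) <= (p - 1) v(x); if x is not
    integral, the right-hand side is negative. *)
Lemma val_pth_power_lt x : x <v z -> x ^+ p <v (1 + x) ^+ p - 1 - x ^+ p.
Proof.
move=> xz; have x0 := vlt_neq0 xz.
rewrite exp1D_prime //; set S := \sum_(i < _) _.
have -> : 1 + x ^+ p + p%:R * S - 1 - x ^+ p = p%:R * S by ring.
rewrite mulr_sumr; apply: vltb_sum; rewrite ?expf_neq0 // => i _.
rewrite mulrCA mulrC; apply: vlt_mul1 => //; last by rewrite vle_nat ?vleb_refl.
have ip : (i.+1 <= p)%N by rewrite (leq_trans (ltn_ord i)) ?leq_pred.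
have -> : x ^+ p = x ^+ (p - i.+1) * x ^+ i.+1 by rewrite -exprD subnK.
rewrite vleb_mulr ?expf_neq0 // pE.
have pi0 : (0 < p - i.+1)%N by rewrite subn_gt0 -ltn_predRL.
case/boolP: (1 <=v x) => hx; last first.
  apply: vlt_trans (vltb_exp hR pi0 hx) _ => //.
  by rewrite expr1n -(expr1n F p.-1) vltb_exp ?val_z_gt0 // -ltnS prednK.
apply: (@vle_lt_trans _ _ hR (x ^+ p.-1)); last by rewrite vltb_exp // -ltnS prednK.
have -> : x ^+ p.-1 = x ^+ (p - i.+1 + i) by congr (_ ^+ _); move: ip; clear; lia.
by rewrite exprD vle_mul1 ?vleb_refl // vle1X.
Qed.

(** The linear term p x z agrees with - z^p x to first order, the top term is z^p x^p, and each term
    in between is a multiple of p z^2, of value above v(p z) = v(z^p). *)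
Lemma val_pth_power_ge x : 1 <=v x ->
  z ^+ p <v (1 + x * z) ^+ p - 1 - z ^+ p * (x ^+ p - x).
Proof.
move=> hx; rewrite exp1D_prime //.
have -> : (p.-1 = p.-2.+1)%N by rewrite prednK // -ltnS prednK.
rewrite big_ord_recl /= bin1 divnn p0 mul1r expr1.
set S := \sum_(i < _) _.
have -> : 1 + (x * z) ^+ p + p%:R * (x * z + S) - 1 - z ^+ p * (x ^+ p - x) =
   (p%:R * z + z ^+ p) * x + p%:R * S by rewrite exprMn; ring.
apply: vltbD => //; first by apply: vlt_mul1.
rewrite /S mulr_sumr; apply: vltb_sum => // i _.
have -> : p%:R * (('C(p, (bump 0 i).+1) %/ p)%:R * (x * z) ^+ (bump 0 i).+1) =
   (p%:R * z) * ((x * z) ^+ i.+1 * ('C(p, (bump 0 i).+1) %/ p)%:R) * x.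
  by rewrite /bump add1n exprS; ring.
rewrite -[X in vleb _ X _]mulrA; apply: (@vle_lt_trans _ _ hR (p%:R * z)).
  by rewrite pzE vleb_refl.
have pz0 : p%:R * z != 0 
  by apply/eqP => e; have := pzE.2 (z ^+ p); rewrite e vle0b vleb_refl // (negPf zp0).
rewrite -[X in vleb _ _ X]mulr1 vleb_mull // vlt1M // vlt1M ?vle_nat ?vleb_refl //.
rewrite -(expr1n F i.+1) vltb_exp // mulrC vlt1M ?val_z_gt0 //.
Qed.

(* The valuation of [(1 + r)^p - 1] switches regime at [v(r) = v(z)]. *)
Lemma pth_power_cases r :
  (r <v z /\ r ^+ p <v (1 + r) ^+ p - 1 - r ^+ p) \/
  (exists2 x, 1 <=v x & r = x * z /\
     z ^+ p <v (1 + r) ^+ p - 1 - z ^+ p * (x ^+ p - x)).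
Proof.
case/boolP: (z <=v r) => h; [right|left]; last by split=> //; apply: val_pth_power_lt.
exists (r / z); first by rewrite vle_div ?mul1r.
by rewrite divfK //; split=> //; rewrite -{1}(divfK z0 r) val_pth_power_ge // vle_div ?mul1r.
Qed.

Lemma val_pth_power_big r : z <=v r -> z ^+ p <=v (1 + r) ^+ p - 1.
Proof.
case: (pth_power_cases r) => [[/negPf->//]|[x hx [_ h]] _].
rewrite -[X in vleb _ _ X](subrK (z ^+ p * (x ^+ p - x))) vlebD ?(vltW _ h) //.
by rewrite vle_mul1 ?vleb_refl // vlebB ?vle1X.
Qed.

Lemma val_pth_power_small r : r <v z ->
  (forall y, (y <=v (1 + r) ^+ p - 1) = (y <=v r ^+ p)) *
  (forall y, ((1 + r) ^+ p - 1 <=v y) = (r ^+ p <=v y)).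
Proof. by move=> /val_pth_power_lt; apply: vle_dom. Qed.

End PthPowers.

(** Expanding (1 + z)^p = 1 gives z^p = - p (z + S), where S collects integral multiples of powers
    z^j with j >= 2. Hence v(z) > 0, so S is negligible against z, and z^p agrees with - p z to
    first order. *)
Lemma prim_root_sub1_val (F : fieldType) (R : pred F) (p : nat) (zeta : F) :
  is_valring R -> prime p -> ~~ vleb R p%:R 1 -> p%:R != 0 :> F -> p.-primitive_root zeta ->
  zeta - 1 != 0 /\ ~~ vleb R (p%:R * (zeta - 1) + (zeta - 1) ^+ p) ((zeta - 1) ^+ p).
Proof.
move=> hR pp hp pn0 hz; set z := zeta - 1.
have p0 := prime_gt0 pp; have p1 := prime_gt1 pp.
have z0 : z != 0.
  rewrite subr_eq0; apply/eqP => e.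
  by have := prim_order_dvd hz 1; rewrite e expr1 eqxx dvdn1 gtn_eqF.
split=> //.
have zeta1 : vleb R 1 zeta by rewrite -(vle1_exp hR _ p0) (prim_expr_order hz) vleb_refl.
have z1 : vleb R 1 z by rewrite vlebB ?vleb_refl.
have := exp1D_prime z pp; rewrite /z subrKC -/z (prim_expr_order hz).
have -> : (p.-1 = p.-2.+1)%N by rewrite prednK // -ltnS prednK.
rewrite big_ord_recl /= bin1 divnn p0 mul1r expr1 => e.
set S := \sum_(i < _) _ in e.
have e1 : z ^+ p = - (p%:R * (z + S)) 
    by apply: (addrI 1); apply: (addIr (p%:R * (z + S))); rewrite -e; ring.
have S1 : vleb R 1 S by apply: vleb_sum => // i _; rewrite vle1M ?vle_nat ?vleb_refl ?vle1X.
have hz1 : ~~ vleb R z 1.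
  by rewrite -(vlex1_exp hR z p0) e1 vleNb // vlt1M // vlebD.
have pz0 : p%:R * z != 0 by rewrite mulf_neq0.
have hS : ~~ vleb R S z.
  apply: vltb_sum => // i _; rewrite /bump add1n exprS mulrC; apply: vlt_mul1 => //.
    rewrite mulrC -{3}[z]mul1r vleb_mulr //.
    by rewrite -(expr1n F i.+1) vltb_exp.
  by rewrite vle_nat ?vleb_refl.
have hpS : ~~ vleb R (p%:R * z + z ^+ p) (p%:R * z).
  have -> : p%:R * z + z ^+ p = - (p%:R * S) by rewrite e1; ring.
  by rewrite vleNb // vleb_mull.
apply: (vle_lt_trans hR _ hpS).
rewrite -vleNb //.
have hd : ~~ vleb R (- z ^+ p - p%:R * z) (p%:R * z) by rewrite -opprD vleNb // [z ^+ p + _]addrC.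
by rewrite (vle_dom hR hd) vleb_refl.
Qed.

(** * Extension of valuation rings *)

Section Chevalley.
Variables (K : fieldType) (L : fieldExtType K) (A : pred K).
Hypothesis hA : is_valring A.

Let A0 : 0 \in A. Proof. by case: hA. Qed.
Let A1 : 1 \in A. Proof. by case: hA. Qed.

(** The condition that S meets K exactly in A takes the place of the prime ideal carried along in
    the usual proof of Chevalley's theorem. *)
Record subring_over (S : set L) : Prop := SubringOver {
  so_base : forall a : K, a \in A -> S a%:A;
  so_sub : forall x y, S x -> S y -> S (x - y);
  so_mul : forall x y, S x -> S y -> S (x * y);
  so_trace : forall a : K, S a%:A -> a \in A }.

Lemma so_zero S : subring_over S -> S 0.
Proof. by move=> hS; have := so_base hS A0; rewrite scale0r. Qed.

Lemma so_one S : subring_over S -> S 1.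
Proof. by move=> hS; have := so_base hS A1; rewrite scale1r. Qed.

Lemma so_add S x y : subring_over S -> S x -> S y -> S (x + y).
Proof.
move=> hS hx hy; rewrite -[y]opprK -[- y]sub0r; apply: so_sub => //.
by apply: so_sub => //; apply: so_zero.
Qed.

Lemma so_sum S n (G : 'I_n -> L) : subring_over S -> (forall i, S (G i)) -> S (\sum_(i < n) G i).
Proof. by move=> hS hG; apply: big_ind => //; [apply: so_zero | move=> x y; apply: so_add]. Qed.

Lemma max_subring_over : exists2 S : set L, subring_over S &
  forall T : set L, (S `<=` T)%classic -> subring_over T -> (T `<=` S)%classic.
Proof.
pose P (S : set L) := S = set0 \/ subring_over S.
have [C CP Ctot|S [PS maxS]] := @Zorn_bigcup L P.
  have [[X CX [x0 Xx0]]|none] := pselect (exists2 X, C X & exists x, X x); last first.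
    left; apply/seteqP; split=> // x [X CX Xx]; apply: none; exists X => //; by exists x.
  have ne Y : C Y -> (exists y, Y y) -> subring_over Y.
    by move=> CY [y Yy]; have [e|//] := CP _ CY; rewrite e in Yy.
  have both x y : (\bigcup_(Y in C) Y)%classic x -> (\bigcup_(Y in C) Y)%classic y ->
      exists2 Y, C Y & Y x /\ Y y.
    move=> [Y CY Yx] [Z CZ Zy]; have [s|s] := Ctot _ _ CY CZ.
      by exists Z => //; split=> //; apply: s.
    by exists Y => //; split=> //; apply: s.
  have hX : subring_over X by apply: ne => //; exists x0.
  right; split.
  - by move=> a ha; exists X => //; apply: so_base.
  - move=> x y hx hy; have [Y CY [Yx Yy]] := both x y hx hy.
    by exists Y => //; apply: so_sub => //; apply: ne => //; exists x.
  - move=> x y hx hy; have [Y CY [Yx Yy]] := both x y hx hy.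
    by exists Y => //; apply: so_mul => //; apply: ne => //; exists x.
  - by move=> a [Y CY Ya]; have hY : subring_over Y; [apply: ne; last exists a%:A | apply: so_trace hY _ Ya].
have hS : subring_over S.
  case: PS => // S0; pose T : set L := fun x => exists2 a : K, a \in A & x = a%:A.
  case: (maxS T).
    by rewrite S0; split=> // /(_ 0); apply; exists 0; rewrite ?scale0r.
  case: hA => _ _ hB hM _.
  right; split=> [a ha|x y [a ha ->] [b hb ->]|x y [a ha ->] [b hb ->]|a [b hb e]].
  - by exists a.
  - by exists (a - b); rewrite ?scalerBl ?hB.
  - by exists (a * b); rewrite ?hM // -scalerAl mul1r scalerA.
  - by rewrite (fmorph_inj (in_alg L) e).
exists S => // T ST hT; apply: contrapT => nTS.
by apply: (maxS T); [split | right].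
Qed.

Section Maximal.
Variable S : set L.
Hypothesis hS : subring_over S.
Hypothesis maxS : forall T : set L, (S `<=` T)%classic -> subring_over T -> (T `<=` S)%classic.

Definition spoly (q : {poly L}) : Prop := forall i, S q`_i.

Lemma spolyM q r : spoly q -> spoly r -> spoly (q * r).
Proof. by move=> hq hr i; rewrite coefM; apply: so_sum => // j; apply: so_mul. Qed.

Lemma spolyB q r : spoly q -> spoly r -> spoly (q - r).
Proof. by move=> hq hr i; rewrite coefB; apply: so_sub. Qed.

Lemma spolyD q r : spoly q -> spoly r -> spoly (q + r).
Proof. by move=> hq hr i; rewrite coefD; apply: so_add. Qed.

Lemma spolyC c : S c -> spoly c%:P.
Proof. by move=> hc i; rewrite coefC; case: eqP => // _; apply: so_zero. Qed.

Lemma notin_vlt a : a \notin A -> ~~ vleb A a^-1 1.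
Proof.
move=> ha; have a0 : a != 0 by apply: contraNneq ha => ->.
by rewrite vlex1V ?invr_eq0 ?invrK.
Qed.

(* Adjoining [x] to the maximal [S] must create an element of [K] outside [A]. *)
Lemma adjoin_notin x : ~ S x -> exists2 a : K, ~~ vleb A a 1 &
  exists2 q, spoly q & a%:A * q.[x] = 1.
Proof.
move=> nSx; apply: contrapT => nex.
pose T : set L := fun y => exists2 q, spoly q & y = q.[x].
have ST : (S `<=` T)%classic.
  by move=> y Sy; exists y%:P; [apply: spolyC | rewrite hornerC].
apply: nSx; apply: (maxS ST).
  split=> [a ha|y z [q hq ->] [r hr ->]|y z [q hq ->] [r hr ->]|a [q hq e]].
  - by apply: ST; apply: so_base.
  - by exists (q - r); rewrite ?hornerE //; apply: spolyB.
  - by exists (q * r); rewrite ?hornerE //; apply: spolyM.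
  (* Here q(x) = a with a outside A, so the multiplier a^-1 lies in the maximal ideal. *)
  apply: contrapT => /negP na; apply: nex; exists a^-1; first exact: notin_vlt.
  exists q => //; rewrite -e -scalerAl mul1r scalerA mulVf ?scale1r //.
  by apply: contraNneq na => ->.
exists 'X; last by rewrite hornerX.
by move=> i; rewrite coefX; case: eqP => _; [apply: so_one | apply: so_zero].
Qed.

(* The relation for [x^-1] eliminates the leading term of the one for [x]. *)
Lemma adjoin_descent a x (q r : {poly L}) : x != 0 -> ~~ vleb A a 1 -> spoly q -> spoly r ->
  a%:A * q.[x] = 1 -> a%:A * r.[x^-1] = 1 -> False.
Proof.
move=> x0 ha; have Sa : S a%:A by apply: so_base; rewrite // -vle1b // vltW.
have [n] := ubnP (size q + size r); elim: n => // n IH in x x0 q r *.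
wlog le_rq : x x0 q r / (size r <= size q)%N => [H|].
  case/orP: (leq_total (size r) (size q)) => h; first exact: H.
  move=> hs hq hr e1 e2; apply: (H (x^-1) _ r q) => //; rewrite ?invr_eq0 ?invrK //.
  by rewrite addnC.
move=> hs hq hr e1 e2.
have q0 : q != 0 by apply: contra_eqN (esym e1) => /eqP->; rewrite horner0 mulr0 oner_eq0.
have [m sq] : exists m, size q = m.+1 by exists (size q).-1; rewrite prednK // size_poly_gt0.
(* A constant q would put a^-1 in S, hence in A, although a lies in the maximal ideal. *)
case: m sq => [|m] sq.
  have e : q = (q`_0)%:P by apply: size1_polyC; rewrite sq.
  have a0 : a != 0 by apply: contra_eqN (esym e1) => /eqP->; rewrite scale0r mul0r oner_eq0.
  have : S (a^-1)%:A.
    have -> : (a^-1)%:A = q`_0.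
      rewrite e hornerC mulr_algl in e1.
      by rewrite -[X in _ *: X]e1 scalerA mulVf // scale1r.
    exact: hq.
  by move/(so_trace hS) => h1; move: ha; rewrite vlex1V // h1.
pose b := q`_m.+1; pose c := r`_0.
pose q1 := \poly_(i < m.+1) q`_i; pose r1 := \poly_(i < m.+1) r`_(m.+1 - i).
have qE : q.[x] = q1.[x] + b * x ^+ m.+1.
  by rewrite horner_coef sq big_ord_recr /= horner_poly.
have rE : x ^+ m.+1 * r.[x^-1] = x ^+ m.+1 * c + r1.[x].
  have sr : (size r <= m.+2)%N by rewrite -sq.
  rewrite (horner_coef_wide _ sr) big_ord_recl expr0 mulr1 mulrDr; congr (_ + _).
  rewrite horner_poly (reindex_inj rev_ord_inj) mulr_sumr; apply: eq_bigr => i _ /=.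
  rewrite /bump add1n subnSK // mulrCA; congr (_ * _).
  rewrite -{1}(subnKC (ltnW (ltn_ord i))) exprD exprVn mulfK ?expf_neq0 //.
(* With n = m + 1, the two relations read 1 = a q1(x) + a b x^n and x^n (1 - a c) = a r1(x).
   Multiplying the first by 1 - a c and substituting the second removes x^n and leaves a s(x) = 1
   with deg s < n. *)
pose s := c%:P + (1 - a%:A * c)%:P * q1 + (a%:A * b)%:P * r1.
have hs1 : spoly q1 by move=> i; rewrite coef_poly; case: ifP => _; [apply: hq | apply: so_zero].
have hs2 : spoly r1 by move=> i; rewrite coef_poly; case: ifP => _; [apply: hr | apply: so_zero].
apply: (IH x x0 s r) => //.
- rewrite -ltnS (leq_trans _ hs) // ltnS ltn_add2r sq ltnS.
  have sC (u : L) (t : {poly L}) : (size t <= m.+1)%N -> (size (u%:P * t)%R <= m.+1)%N.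
    by move=> ht; rewrite mul_polyC (leq_trans (size_scale_leq _ _)).
  rewrite (leq_trans (size_polyD _ _)) // geq_max sC ?size_poly // andbT.
  rewrite (leq_trans (size_polyD _ _)) // geq_max sC ?size_poly // andbT.
  by rewrite (leq_trans (size_polyC_leq1 _)).
- have S1c : S (1 - a%:A * c).
    by apply: so_sub => //; [apply: so_one | apply: so_mul; rewrite //; apply: hr].
  apply: spolyD; first apply: spolyD; [|apply: spolyM|apply: spolyM] => //; apply: spolyC => //.
    exact: hr.
  by apply: so_mul => //; apply: hq.
rewrite /s !hornerE.
have e3 : a%:A * r1.[x] = x ^+ m.+1 * (1 - a%:A * c).
  have -> : r1.[x] = x ^+ m.+1 * r.[x^-1] - x ^+ m.+1 * c by rewrite rE; ring.
  by rewrite mulrBr mulrCA e2; ring.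
have e4 : a%:A * q1.[x] = 1 - a%:A * b * x ^+ m.+1 
  by apply/eqP; rewrite eq_sym subr_eq -[_ * b * _]mulrA -mulrDr -qE e1.
have -> : a%:A * (c + (1 - a%:A * c) * q1.[x] + a%:A * b * r1.[x]) =
  a%:A * c + (1 - a%:A * c) * (a%:A * q1.[x]) + a%:A * b * (a%:A * r1.[x]) by ring.
by rewrite e3 e4; ring.
Qed.

(** If x and x^-1 both lie outside S, each yields a relation with its own multiplier. The multiplier
    of larger value is an A-multiple of the other, so both relations can be rewritten with a common
    one, as the descent requires. *)
Lemma max_subring_valring x : x != 0 -> S x \/ S x^-1.
Proof.
move=> x0; apply: contrapT => /not_orP[/adjoin_notin[a ha [q hq eq]] /adjoin_notin[b hb [r hr er]]].
have weaken a' b' t y : vleb A a' b' -> spoly t -> b'%:A * t.[y] = 1 ->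
    exists2 t', spoly t' & a'%:A * t'.[y] = 1.
  move=> /(vleP hA)[d hd ->] ht e; exists ((d%:A)%:P * t).
    by apply: spolyM => //; apply: spolyC; apply: so_base.
  by rewrite hornerM hornerC -[RHS]e mulrA mulr_algl scalerA [a' * d]mulrC.
case/orP: (vleb_total hA a b) => h.
  by have [r' hr' er'] := weaken _ _ _ _ h hr er; apply: (adjoin_descent x0 ha hq hr').
by have [q' hq' eq'] := weaken _ _ _ _ h hq eq; apply: (adjoin_descent x0 hb hq' hr).
Qed.
End Maximal.

Theorem valring_extension : exists B : pred L, extends_val A B.
Proof.
have [S hS maxS] := max_subring_over.
have inS x : (x \in [pred y | `[< S y >]]) = `[< S x >] by [].
exists [pred x | `[< S x >]]; split; last first.
  by move=> a; rewrite inS; apply/asboolP/idP => [/(so_trace hS)|/(so_base hS)].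
split; rewrite ?inS.
- by apply/asboolP/(so_zero hS).
- by apply/asboolP/(so_one hS).
- by move=> x y; rewrite !inS => /asboolP hx /asboolP hy; apply/asboolP/(so_sub hS).
- by move=> x y; rewrite !inS => /asboolP hx /asboolP hy; apply/asboolP/(so_mul hS).
by move=> x /(max_subring_valring hS maxS)[]; [left|right]; rewrite inS; apply/asboolP.
Qed.
End Chevalley.

(** * Divisibility of values by p and exponents prime to p *)

Lemma prime_bezout p i : prime p -> (0 < i < p)%N ->
  exists u v, (i * u = p * v + 1)%N.
Proof.
move=> pp /andP[i0 ip].
have : coprime i p by rewrite coprime_sym prime_coprime // gtnNdvd.
case/(coprimeP _ i0) => -[u v] /= e; by exists u, v; lia.
Qed.

Section Divisibility.
Variables (F : fieldType) (R : pred F) (hR : is_valring R).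

(** Writing i u = p v + 1 shows that x is (x^i)^u up to a p-th power. *)
Lemma pdivv_exp p i x : prime p -> (0 < i < p)%N -> x != 0 ->
  pdivv R p (x ^+ i) -> pdivv R p x.
Proof.
move=> pp hi x0 [g [g0 /(veqP hR)/andP[h1 h2]]].
have [u [v e]] := prime_bezout pp hi.
exists (g ^+ u / x ^+ v); split; first by rewrite mulf_neq0 ?invr_eq0 ?expf_neq0.
have xE : x = x ^+ i ^+ u / x ^+ v ^+ p.
  by rewrite -!exprM e addn1 exprS [(v * p)%N]mulnC mulfK // expf_neq0.
have gE : (g ^+ u / x ^+ v) ^+ p = g ^+ p ^+ u / x ^+ v ^+ p.
  by rewrite exprMn exprVn -!exprM mulnC.
by apply/(veqP hR); rewrite gE {1 4}xE !vleb_mulr ?vleb_exp // invr_eq0 !expf_neq0.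
Qed.

End Divisibility.

(** * Valuation bases *)

Section ValuationBases.
Variables (K : fieldType) (L : fieldExtType K) (A : pred K) (B : pred L).
Hypotheses (hA : is_valring A) (hAB : extends_val A B).
Let hB : is_valring B := hAB.1.

Lemma alg_neq0 (x : K) : (x%:A != 0 :> L) = (x != 0).
Proof. by rewrite (fmorph_eq0 (in_alg L)). Qed.

Lemma vle_ext x y : vleb B x%:A y%:A = vleb A x y.
Proof.
rewrite /vleb !(fmorph_eq0 (in_alg L)) -(fmorph_div (in_alg L)) /=.
by case: hAB => _ ->.
Qed.

Lemma vle_ext1 x : vleb B 1 x%:A = vleb A 1 x.
Proof. by rewrite -vle_ext scale1r. Qed.

Lemma vle_ext1r x : vleb B x%:A 1 = vleb A x 1.
Proof. by rewrite -vle_ext scale1r. Qed.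

(** The value of a combination is then the minimum of the values of its terms, the other inequality
    being automatic. *)
Definition val_indep (I : finType) (w : I -> L) : Prop :=
  (forall i, w i != 0) /\
  forall (c : I -> K) k, vleb B (\sum_i (c i)%:A * w i) ((c k)%:A * w k).

Lemma val_indep_span (I : finType) (w : I -> L) : val_indep w -> #|I| = \dim {:L} ->
  forall y, exists c : I -> K, y = \sum_i (c i)%:A * w i.
Proof.
move=> [w0 hw] cI y; pose X := [tuple w (enum_val i) | i < #|I|].
have XE (i : 'I_#|I|) : X`_i = w (enum_val i) by rewrite -tnth_nth tnth_mktuple.
have fX : free X.
  apply/freeP => c hc i; have := hw (fun j => c (enum_rank j)) (enum_val i).
  rewrite (reindex _ (onW_bij _ (enum_val_bij I))).
  under eq_bigr => j _ do rewrite enum_valK mulr_algl -XE.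
  rewrite hc vle0b enum_valK mulf_eq0 (negPf (w0 _)) orbF => /eqP h.
  by apply/eqP; apply: contraT; rewrite -alg_neq0 h eqxx.
have bX : basis_of fullv X by rewrite basisEfree fX subvf size_tuple cI leqnn.
exists (fun i => coord X (enum_rank i) y); rewrite {1}(coord_basis bX (memvf y)).
rewrite [RHS](reindex _ (onW_bij _ (enum_val_bij I))).
by apply: eq_bigr => i _; rewrite enum_valK XE mulr_algl.
Qed.

Lemma val_attained (I : finType) (y : I -> L) : (0 < #|I|)%N ->
  exists k, vleb B (y k) (\sum_i y i).
Proof.
move=> cI; have [|k _ hk] := @vle_min _ _ hB _ (enum I) y; first by rewrite -size_eq0 -cardE -lt0n.
by exists k; apply: vleb_sum => // i _; apply: hk; rewrite mem_enum.
Qed.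

(* A best approximation of [alpha] by constants is found among the finitely many
   ratios of the coordinates of [alpha] and [1]. *)
Lemma best_approximation (I : finType) (w : I -> L) (alpha : L) :
  val_indep w -> #|I| = \dim {:L} ->
  exists c : K, forall c' : K, vleb B (alpha - c'%:A) (alpha - c%:A).
Proof.
move=> vw cI; have [w0 hw] := vw.
have [a aE] := val_indep_span vw cI alpha; have [d dE] := val_indep_span vw cI 1.
have subE c : alpha - c%:A = \sum_i (a i - c * d i)%:A * w i.
  have -> : c%:A = \sum_i (c * d i) *: w i.
    by rewrite dE scaler_sumr; apply: eq_bigr => i _; rewrite mulr_algl scalerA.
  by rewrite aE -sumrB; apply: eq_bigr => i _; rewrite !mulr_algl scalerBl.
pose s := [seq k <- enum I | d k != 0].
have s0 : s != [::].
  apply: contra_eqN dE => /eqP se; rewrite big1 ?oner_eq0 // => k _.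
  have : k \notin s by rewrite se.
  by rewrite mem_filter mem_enum andbT negbK => /eqP->; rewrite scale0r mul0r.
have [k _ hk] := vle_max hB (fun k => alpha - (a k / d k)%:A) s0.
exists (a k / d k) => c.
(* The ratio closest to c serves alpha at least as well as c: by the maximality of v(a_l / d_l - c),
   each difference a_i / d_i - a_l / d_l has value at least v(a_i / d_i - c), so every coordinate of
   alpha - a_l / d_l dominates that of alpha - c. *)
have [l ls hl] := vle_max hA (fun k => a k / d k - c) s0.
apply: (vleb_trans hB) (hk l ls); rewrite [X in vleb _ _ X]subE; apply: vleb_sum => // i _.
have [di|di] := eqVneq (d i) 0.
  by have := hw (fun i => a i - c * d i) i; rewrite -subE di !mulr0.
have := hw (fun i => a i - c * d i) i; rewrite -subE => h; apply: (vleb_trans hB) h _.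
rewrite vleb_mulr // vle_ext.
have -> : a i - c * d i = (a i / d i - c) * d i by rewrite mulrBl divfK.
have -> : a i - a l / d l * d i = ((a i / d i - c) - (a l / d l - c)) * d i.
  by rewrite !mulrBl divfK //; ring.
by rewrite vleb_mulr // vlebB ?vleb_refl // hl // mem_filter di mem_enum.
Qed.

Definition res_indep n (b : 'I_n -> L) : Prop :=
  (forall i, b i \in B) /\
  (forall c : 'I_n -> K, (forall i, c i \in A) ->
     maxid B (\sum_i (c i)%:A * b i) -> forall i, maxid A (c i)).

(** Dividing by a coefficient of least value produces integral coefficients, one of them equal to 1,
    and independence of the residues keeps the new sum out of the maximal ideal. The index [k] only
    witnesses that the family is not empty. *)
Lemma res_indep_min n (b : 'I_n -> L) (c : 'I_n -> K) : res_indep b ->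
  forall k : 'I_n, exists j, [/\ forall i, vleb A (c j) (c i),
    vleb B (\sum_i (c i)%:A * b i) (c j)%:A & vleb B (c j)%:A (\sum_i (c i)%:A * b i)].
Proof.
move=> [bB hb] k; have [|j _ hj] := @vle_min _ _ hA _ (enum 'I_n) c.
  by apply/eqP => h; have := mem_enum 'I_n k; rewrite h.
have {}hj i : vleb A (c j) (c i) by apply: hj; rewrite mem_enum.
exists j; split=> //; last first.
  by apply: vleb_sum => // i _; apply: vle_mul1; rewrite // ?vle_ext // vle1b.
have [cj|cj] := eqVneq (c j) 0.
  rewrite big1 ?cj ?scale0r ?vleb0 // => i _.
  by have := hj i; rewrite cj vle0b => /eqP->; rewrite scale0r mul0r.
have -> : \sum_i (c i)%:A * b i = (c j)%:A * \sum_i (c i / c j)%:A * b i.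
  rewrite mulr_sumr; apply: eq_bigr => i _.
  by rewrite !mulr_algl scalerA [c j * _]mulrC divfK.
rewrite -[X in vleb _ _ X]mulr1 vleb_mull ?alg_neq0 //; apply: contraT => h.
have := hb (fun i => c i / c j) _ _ j; rewrite divff //.
case/(_ _ _)/(maxidP hA)/negP; rewrite ?vleb_refl //; last exact/maxidP.
by move=> i; rewrite -vle1b // vle_div ?mul1r.
Qed.

Lemma res_indep_neq0 n (b : 'I_n -> L) k : res_indep b -> b k != 0.
Proof.
move=> hb; have [j [h1 h2 _]] := res_indep_min (fun i => (i == k)%:R) hb k.
apply: contraTneq h2 => bk; rewrite (bigD1 k) //= bk mulr0 add0r big1 => [|i /negPf ->].
  rewrite vle0b (fmorph_eq0 (in_alg L)).
  by have := h1 k; apply: contraTneq => ->; rewrite eqxx vle0b oner_eq0.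
by rewrite scale0r mul0r.
Qed.

Lemma res_indep_val n (b : 'I_n -> L) : res_indep b -> val_indep b.
Proof.
move=> hb; split=> [i|c k]; first exact: res_indep_neq0.
have [j [h1 h2 _]] := res_indep_min c hb k; apply: (vleb_trans hB h2).
by apply: vle_mul1; rewrite ?vle_ext // vle1b //; case: hb.
Qed.

(** Grouping by the first index gives inner sums whose values lie in v(K). The outer terms then lie
    in distinct cosets of v(K), so they have distinct values and cannot cancel. *)
Lemma standard_val_indep e f (x : 'I_e -> L) (b : 'I_f -> L) :
  (forall i, x i != 0) ->
  (forall i j, (exists2 a : K, a != 0 & veq B (x i) (a%:A * x j)) -> i = j) ->
  res_indep b -> val_indep (fun k : 'I_e * 'I_f => x k.1 * b k.2).
Proof.
move=> x0 hx hb; split=> [[i j]|c [i j]] /=; first by rewrite mulf_neq0 // res_indep_neq0.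
pose s i := \sum_j (c (i, j))%:A * b j.
have -> : \sum_k (c k)%:A * (x k.1 * b k.2) = \sum_i x i * s i.
  rewrite /s; under [RHS]eq_bigr => i' _ do rewrite mulr_sumr.
  rewrite pair_bigA /=; apply: eq_bigr => -[i' j'] _ /=; exact: mulrCA.
have [l [h1 h2 _]] := res_indep_min (fun j => c (i, j)) hb j.
apply: (@vleb_trans _ _ hB (x i * s i)); last first.
  rewrite mulrCA vleb_mull //; apply: (vleb_trans hB h2).
  by apply: vle_mul1; rewrite ?vle_ext // vle1b //; case: hb.
apply: (vle_sum_distinct hB (y := fun i => x i * s i)) => i1 i2 nz h12 h21.
have [j1 [_ g1 g2]] := res_indep_min (fun j => c (i1, j)) hb j.
have [j2 [_ g3 g4]] := res_indep_min (fun j => c (i2, j)) hb j.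
rewrite -/(s i1) in g1 g2; rewrite -/(s i2) in g3 g4.
have s1 : s i1 != 0 by move: nz; rewrite mulf_eq0 negb_or => /andP[].
have s2 : s i2 != 0 by apply: contraTneq h21 => ->; rewrite mulr0 vle0b.
have c1 : c (i1, j1) != 0 by rewrite -alg_neq0; apply: contraTneq g2 => ->; rewrite vle0b.
have c2 : c (i2, j2) != 0 by rewrite -alg_neq0; apply: contraTneq g4 => ->; rewrite vle0b.
apply: hx; exists (c (i2, j2) / c (i1, j1)); first by rewrite mulf_neq0 ?invr_eq0.
have -> : (c (i2, j2) / c (i1, j1))%:A * x i2 = x i2 * (c (i2, j2))%:A / (c (i1, j1))%:A.
  by rewrite -mulrA -(fmorph_div (in_alg L)) mulrC.
have c1' : (c (i1, j1))%:A != 0 :> L by rewrite alg_neq0.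
apply/(veqP hB); rewrite vle_div // vle_divl //; apply/andP; split.
  apply: (@vleb_trans _ _ hB (x i1 * s i1)); first by rewrite vleb_mull.
  by apply: (vleb_trans hB h12); rewrite vleb_mull.
apply: (@vleb_trans _ _ hB (x i2 * s i2)); first by rewrite vleb_mull.
by apply: (vleb_trans hB h21); rewrite vleb_mull.
Qed.

Lemma inertial_defectless n (b : 'I_n -> L) : (0 < n)%N -> \dim {:L} = n -> res_indep b ->
  ram_index B 1 /\ res_degree A B n.
Proof.
move=> n0 dn hb; have vb := res_indep_val hb.
have span := val_indep_span vb _; rewrite card_ord dn in span.
split; last first.
  exists b; split; [by case: hb | by case: hb |].
  move=> y yB; have [c yE] := span erefl y; exists c; last first.
    by apply/maxidP; rewrite // yE subrr vltb0 oner_eq0.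
  move=> i; have [j [h1 h2 h3]] := res_indep_min c hb i.
  rewrite -vle1b //; apply: vleb_trans (h1 i) => //.
  by rewrite -vle_ext1; apply: vleb_trans h2 => //; rewrite -yE vle1b.
exists (fun _ => 1); split=> [_|i j _|y y0]; rewrite ?oner_eq0 // ?(ord1 i) ?(ord1 j) //.
exists ord0; have [c yE] := span erefl y.
have [j [h1 h2 h3]] := res_indep_min c hb (Ordinal n0); rewrite -yE in h2 h3.
exists (c j); last by rewrite mulr1; apply/veqP; rewrite // h2.
by rewrite -alg_neq0; apply: contraTneq h3 => ->; rewrite vle0b.
Qed.

(** The powers of gamma below p lie in distinct cosets of v(K): if v(gamma^m) were in v(K) with 0 <
    m < p, then p would divide v(t^m), hence v(t). *)
Lemma ramified_defectless p (gamma : L) (t : K) : prime p -> \dim {:L} = p -> t != 0 ->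
  ~ pdivv A p t -> veq B (gamma ^+ p) t%:A -> ram_index B p /\ res_degree A B 1.
Proof.
move=> pp dp t0 ht /(veqP hB)/andP[g1 g2]; have p0 := prime_gt0 pp.
have gamma0 : gamma != 0.
  by apply: contraTneq g1 => ->; rewrite expr0n gtn_eqF // vle0b alg_neq0.
pose x (i : 'I_p) := gamma ^+ i.
have x0 i : x i != 0 by rewrite expf_neq0.
have lt_inj (i j : 'I_p) (a : K) : a != 0 -> (i < j)%N ->
    vleb B (gamma ^+ i) (a%:A * gamma ^+ j) -> vleb B (a%:A * gamma ^+ j) (gamma ^+ i) -> False.
  move=> a0 ij; have -> : gamma ^+ j = gamma ^+ (j - i) * gamma ^+ i.
    by rewrite -exprD subnK // ltnW.
  have q1 u : vleb B (gamma ^+ i) (u * gamma ^+ i) = vleb B 1 u.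
    by rewrite -{1}[gamma ^+ i]mul1r vleb_mulr ?expf_neq0.
  have q2 u : vleb B (u * gamma ^+ i) (gamma ^+ i) = vleb B u 1.
    by rewrite -{2}[gamma ^+ i]mul1r vleb_mulr ?expf_neq0.
  rewrite mulrA q1 q2; set m := (j - i)%N => /(vleb_exp hB p) h1 /(vleb_exp hB p) h2.
  rewrite expr1n !exprMn -exprM mulnC exprM in h1 h2.
  apply/ht/(@pdivv_exp _ _ hA _ m) => //.
    by rewrite subn_gt0 ij (leq_ltn_trans (leq_subr _ _)).
  exists a^-1; split; first by rewrite invr_eq0.
  have E : (t ^+ m * a ^+ p)%:A = a%:A ^+ p * t%:A ^+ m :> L.
    by rewrite -!(rmorphXn (in_alg L)) -(rmorphM (in_alg L)) mulrC.
  apply/(veqP hA); rewrite exprVn -div1r vle_div ?expf_neq0 // vle_divl ?expf_neq0 //.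
  rewrite -vle_ext1 -vle_ext1r E.
  apply/andP; split; [apply: vleb_trans h2 => // | apply: (vleb_trans hB h1) => //];
    by rewrite vleb_mull ?expf_neq0 ?alg_neq0 // vleb_exp.
have hx (i j : 'I_p) : (exists2 a : K, a != 0 & veq B (x i) (a%:A * x j)) -> i = j.
  move=> [a a0 /(veqP hB)/andP[h1 h2]]; apply/eqP; apply: contraT.
  rewrite neq_ltn => /orP[ij|ji]; first by case: (lt_inj i j a a0 ij h1 h2).
  have a0' : a%:A != 0 :> L by rewrite alg_neq0.
  have aV : (a^-1)%:A = a%:A^-1 :> L by exact: (fmorphV (in_alg L) a).
  have ai : a^-1 != 0 by rewrite invr_eq0.
  case: (lt_inj j i a^-1 ai ji); rewrite -/(x i) -/(x j) aV mulrC.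
    by rewrite vle_div // mulrC.
  by rewrite vle_divl // mulrC.
have one_indep : res_indep (fun _ : 'I_1 => 1 : L).
  split=> [_|c cA]; first by rewrite -vle1b ?vleb_refl.
  rewrite big_ord1 mulr1 => /(maxidP hB); rewrite vle_ext1r => h i.
  by rewrite (ord1 i); apply/maxidP.
have vx := standard_val_indep x0 hx one_indep.
have cI : #|{: 'I_p * 'I_1}| = p by rewrite card_prod !card_ord muln1.
have span := val_indep_span vx (etrans cI (esym dp)).
have [_ vx2] := vx.
split.
  exists x; split=> // y y0; have [c yE] := span y.
  have [|k hk] := @val_attained _ (fun k => (c k)%:A * (x k.1 * 1)); first by rewrite cI.
  rewrite -yE in hk; exists k.1, (c k).
    by rewrite -alg_neq0; apply: contraTneq hk => ->; rewrite mul0r vle0b.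
  apply/(veqP hB); rewrite -[x k.1]mulr1 hk andbT yE; exact: vx2.
exists (fun _ => 1); split; [by case: one_indep | by case: one_indep | move=> y yB].
have [c yE] := span y; pose k0 : 'I_p * 'I_1 := (Ordinal p0, ord0).
have le1 k : vleb B 1 ((c k)%:A * (x k.1 * 1)).
  by apply: (@vleb_trans _ _ hB y); rewrite ?vle1b // yE; apply: vx2.
have xk0 : x k0.1 = 1 by [].
exists (fun _ => c k0) => [_|].
  by have := le1 k0; rewrite xk0 !mulr1 vle_ext1 vle1b.
(* All terms of an integral y are integral. A nonconstant term of value 0 would put a power of gamma
   in the coset of 1, so y is congruent to its constant term. *)
apply/(maxidP hB); rewrite big_ord1 yE (bigD1 k0) //= xk0 !mulr1 addrC addrK.
apply: vltb_sum; rewrite ?oner_eq0 // => k ne.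
apply: contra ne => h; have := le1 k; rewrite mulr1 in h * => h'.
suff e : k0.1 = k.1 by case: k e {h h'} => i j /= <-; rewrite [j]ord1.
apply: hx; exists (c k); last by apply/(veqP hB); rewrite xk0 h h'.
by rewrite -alg_neq0; apply: contraTneq h => ->; rewrite mul0r vle0b oner_eq0.
Qed.
End ValuationBases.

(** * The residue field extension l/k *)

Section ResidueExtension.
Variables (K : fieldType) (L : fieldExtType K) (A : pred K) (B : pred L).
Hypotheses (hA : is_valring A) (hAB : extends_val A B).
Let hB : is_valring B := hAB.1.
Local Notation k := (residue hA).
Local Notation l := (residue hB).

Definition res_ext (a : k) : l := res hB (val a)%:A.

Lemma res_extE x : vleb A 1 x -> res_ext (res hA x) = res hB x%:A.
Proof.
move=> hx; apply/resE; rewrite ?(vle_ext1 hAB) ?vle1_val //.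
by rewrite -scalerBl (vle_ext1r hAB) // val_res_sub.
Qed.

Fact res_ext_is_zmod_morphism : zmod_morphism res_ext.
Proof.
move=> a b; have [x hx ->] := res_surj a; have [y hy ->] := res_surj b.
by rewrite -resB // !res_extE ?vlebB // -resB ?(vle_ext1 hAB) // scalerBl.
Qed.

Fact res_ext_is_monoid_morphism : monoid_morphism res_ext.
Proof.
split=> [|a b]; first by rewrite -(res1 hA) res_extE ?vleb_refl // scale1r.
have [x hx ->] := res_surj a; have [y hy ->] := res_surj b.
by rewrite -resM // !res_extE ?vle1M // -resM ?(vle_ext1 hAB) // mulr_algl scalerA.
Qed.

HB.instance Definition _ := GRing.isZmodMorphism.Build k l res_ext res_ext_is_zmod_morphism.
HB.instance Definition _ := GRing.isMonoidMorphism.Build k l res_ext res_ext_is_monoid_morphism.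

(** The residue of gamma is a root of X^p - eps X - c, which has no root in k; by
    [root_translates_free] no nonzero polynomial of degree below p over k vanishes at it. *)
Lemma res_indep_root p (eps : bool) (c : K) (gamma : L) :
  prime p -> ~~ vleb A p%:R 1 -> vleb A 1 c -> vleb B 1 gamma ->
  ~~ vleb B (gamma ^+ p - eps%:R * gamma - c%:A) 1 ->
  (forall x, vleb A 1 x -> vleb A (x ^+ p - eps%:R * x - c) 1) ->
  res_indep A B (fun i : 'I_p => gamma ^+ i).
Proof.
move=> pp hp hc hg rg nr; split=> [i|d dA]; first by rewrite -vle1b // vle1X.
have {}dA i : vleb A 1 (d i) by rewrite vle1b.
have pl : p \in [pchar l].
  apply: res_pchar => //; have -> : (p%:R : L) = (p%:R)%:A by rewrite scaler_nat.
  by rewrite (vle_ext1r hAB).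
have eps1 (F : fieldType) (R : pred F) : is_valring R -> vleb R 1 eps%:R.
  by move=> hR; rewrite vle_nat ?vleb_refl.
move=> /(maxidP hB) hd i; apply/(maxidP hA); rewrite -(res_eq0 hA) //.
(* The default 0 is never read, since [\poly_(i < p)] only uses indices below p. *)
pose g : {poly k} := \poly_(i < p) (if insub i is Some j then res hA (d j) else 0).
have gE (j : 'I_p) : g`_j = res hA (d j) by rewrite coef_poly ltn_ord valK.
rewrite -gE; suff -> : g = 0 by rewrite coef0.
apply: (@root_translates_free _ _ res_ext _ pl eps (res hA c) (res hB gamma)).
- rewrite /= res_extE //; apply/eqP; rewrite -subr_eq0 -(res_nat hB) -resX // -resM ?eps1 //.
  have h1 : vleb B 1 (gamma ^+ p - eps%:R * gamma) by rewrite vlebB ?vle1M ?vle1X ?eps1.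
  rewrite -(resB hB (vle1X hB p hg) (vle1M hB (eps1 _ _ hB) hg)).
  rewrite -(resB hB h1) ?(vle_ext1 hAB) // (res_eq0 hB) //.
  by apply: (vlebB hB h1); rewrite (vle_ext1 hAB).
- move=> a; have [x hx ->] := res_surj a; apply: contraTN (nr x hx) => e.
  have h1 : vleb A 1 (x ^+ p - eps%:R * x) by rewrite vlebB ?vle1M ?vle1X ?eps1.
  rewrite -(res_nat hA) -resX // -resM ?eps1 // in e.
  rewrite -(resB hA (vle1X hA p hx) (vle1M hA (eps1 _ _ hA) hx)) in e.
  by rewrite -(res_eq0 hA) ?(resB hA h1) ?subr_eq0 //; apply: (vlebB hA h1).
- exact: size_poly.
rewrite /root (@horner_coef_wide _ p) ?size_map_poly ?size_poly //.
apply/eqP; transitivity (res hB (\sum_(i < p) (d i)%:A * gamma ^+ i)).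
  rewrite res_sum => [|j]; last by rewrite vle1M ?(vle_ext1 hAB) ?vle1X.
  apply: eq_bigr => j _; rewrite coef_map /= gE res_extE // resM ?(vle_ext1 hAB) ?vle1X //.
  by rewrite resX.
by apply/eqP; rewrite (res_eq0 hB) //; exact: (vltW hB hd).
Qed.
End ResidueExtension.

Section ResiduePredicates.
Variables (K : fieldType) (A : pred K) (hA : is_valring A) (p : nat).

Lemma res_ppowP u : vleb A 1 u -> res_ppow A p u <-> exists a : residue hA, res hA u = a ^+ p.
Proof.
move=> hu; split=> [[x xA /(maxidP hA) h]|[a]].
  rewrite -vle1b // in xA; exists (res hA x); rewrite -resX //.
  by apply/resE => //; rewrite vle1X.
have [x hx -> e] := res_surj a; exists x; rewrite -?vle1b //; apply/(maxidP hA).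
by apply/(resE hA); rewrite ?vle1X // resX.
Qed.

Lemma res_ASP c : vleb A 1 c -> res_AS A p c <-> exists a : residue hA, res hA c = a ^+ p - a.
Proof.
move=> hu; split=> [[x xA /(maxidP hA) h]|[a]].
  rewrite -vle1b // in xA; exists (res hA x); rewrite -resX // -resB ?vle1X //.
  by apply/resE => //; rewrite vlebB ?vle1X.
have [x hx -> e] := res_surj a; exists x; rewrite -?vle1b //; apply/(maxidP hA).
by apply/(resE hA); rewrite ?vlebB ?vle1X // resB ?resX ?vle1X.
Qed.
End ResiduePredicates.

(** * Kummer generators *)

Lemma alg_mul (K : fieldType) (L : fieldExtType K) (x y : K) : (x * y)%:A = x%:A * y%:A :> L.
Proof. exact: (rmorphM (in_alg L)). Qed.

Lemma alg_exp (K : fieldType) (L : fieldExtType K) (x : K) n : (x ^+ n)%:A = x%:A ^+ n :> L.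
Proof. exact: (rmorphXn (in_alg L)). Qed.

Lemma alg_inv (K : fieldType) (L : fieldExtType K) (x : K) : (x^-1)%:A = x%:A^-1 :> L.
Proof. exact: (fmorphV (in_alg L)). Qed.

Section KummerGenerators.
Variables (p : nat) (K : fieldType) (L : fieldExtType K).
Hypotheses (pp : prime p) (dimL : \dim {:L} = p).

(** The degree is prime, so there is no proper intermediate field and any element outside K
    generates L. *)
Lemma generatesP h :
  generates L p h <-> exists2 alpha : L, alpha ^+ p = h%:A & forall c : K, alpha != c%:A.
Proof.
split=> [[alpha [e full]]|[alpha e nc]]; exists alpha; rewrite // ?e.
  move=> c; apply/eqP => ac; have : alpha \in 1%VS by rewrite ac memvZ // mem1v.
  move=> /Fadjoin_idP/(congr1 (fun V => \dim V)).
  rewrite full dimL dimv1 => p1; by have := prime_gt1 pp; rewrite p1.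
split=> //; apply/eqP; rewrite eqEdim subvf dimL.
have dv : (\dim <<1; alpha>> %| p)%N by rewrite -dimL field_dimS // subvf.
suff d1 : \dim <<1; alpha>> != 1%N. by rewrite (prime_nt_dvdP pp d1 dv) leqnn.
apply/eqP => d1; have e1 : 1%VS = <<1; alpha>>%VS.
  by apply/eqP; rewrite eqEdim d1 dimv1 leqnn andbT (subv_adjoin 1%AS).
have /vlineP[c ac] : alpha \in (1 : {vspace L})%VS by rewrite e1 (memv_adjoin 1%AS).
by have := nc c; rewrite ac eqxx.
Qed.

Lemma generates_neq0 h : generates L p h -> h != 0.
Proof.
move=> /generatesP[alpha e nc]; have := nc 0; rewrite scale0r; apply: contraNneq => h0.
by move: e; rewrite h0 scale0r => /eqP; rewrite expf_eq0 prime_gt0.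
Qed.

Lemma generates_exp_mul h g i : generates L p h -> g != 0 -> (0 < i < p)%N ->
  generates L p (h ^+ i * g ^+ p).
Proof.
move=> gh g0 hi; have h0 := generates_neq0 gh; move/generatesP: gh => [alpha e nc].
apply/generatesP; exists (alpha ^+ i * g%:A).
  by rewrite alg_mul !alg_exp exprMn -e -!exprM mulnC.
move=> c; have [u [v uv]] := prime_bezout pp hi.
(* If alpha^i g = c, then (c / g)^u = alpha^(i u) = h^v alpha, so alpha would be this constant. *)
apply: contra (nc ((c / g) ^+ u / h ^+ v)) => /eqP ce.
have g0' : g%:A != 0 :> L by rewrite alg_neq0.
have hv0 : h%:A ^+ v != 0 :> L by rewrite expf_neq0 ?alg_neq0.
rewrite alg_mul alg_inv !alg_exp alg_mul alg_inv -ce mulfK //; apply/eqP/(canRL (mulfK hv0)).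
by rewrite -e -!exprM -exprS uv addn1.
Qed.

Lemma generates_mul h g : generates L p h -> g != 0 -> generates L p (h * g ^+ p).
Proof. by move=> gh g0; have := @generates_exp_mul h g 1 gh g0; rewrite prime_gt1 // expr1; apply. Qed.

Lemma generates_inv h : generates L p h -> generates L p h^-1.
Proof.
move=> /generatesP[alpha e nc]; apply/generatesP; exists alpha^-1.
  by rewrite exprVn e alg_inv.
move=> c; apply: contra (nc c^-1) => /eqP ce.
by rewrite -[alpha]invrK ce alg_inv.
Qed.

(** If h = x^p, then alpha / x is a p-th root of unity, hence a power of zeta, and alpha lies in
    K. *)
Lemma generates_not_pth_power (zeta h x : K) : p.-primitive_root zeta -> generates L p h -> h != x ^+ p.
Proof.
move=> hz gh; have h0 := generates_neq0 gh; move/generatesP: gh => [alpha e nc].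
apply/eqP => hx; have x0 : x != 0.
  by apply: contra_neqN h0 => /eqP x0; rewrite hx x0 expr0n gtn_eqF ?prime_gt0.
have hz' : p.-primitive_root (zeta%:A : L) by rewrite (fmorph_primitive_root (in_alg L)).
have : (alpha / x%:A) ^+ p = 1.
  by rewrite expr_div_n e hx alg_exp divff // expf_neq0 ?alg_neq0.
move=> /(prim_rootP hz')[i] /(canRL (divfK _)) ai; have := nc (zeta ^+ i * x).
by rewrite ai ?alg_neq0 // alg_mul alg_exp eqxx.
Qed.

Section Hensel.
Variables (A : pred K) (zeta : K).
Hypotheses (hA : is_valring A) (henA : henselian A) (hzeta : p.-primitive_root zeta).
Hypotheses (hp : ~~ vleb A p%:R 1) (pn0 : p%:R != 0 :> K).
Local Notation z := (zeta - 1).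

(* Otherwise [((1 + z X)^p - h) / z^p] is an integral monic polynomial reducing
   to [X^p - X], and Hensel's lemma at 0 makes [h] a p-th power. *)
Lemma generates_val_le h : generates L p h -> vleb A (h - 1) (z ^+ p).
Proof.
move=> gh; apply: contraT => ht.
have [z0 hz] := prim_root_sub1_val hA pp hp pn0 hzeta.
have p1 := prime_gt1 pp; have p0 := prime_gt0 pp.
have zp0 : z ^+ p != 0 by rewrite expf_neq0.
have zgt := val_z_gt0 hA pp hp z0 hz.
pose cf i : K := if i is i'.+1 then p%:R * ('C(p, i) %/ p)%:R * z ^+ i / z ^+ p
                 else - (h - 1) / z ^+ p.
pose f : {poly K} := 'X^p + \poly_(i < p) cf i.
have fi i : f`_i = (i == p)%:R + (if (i < p)%N then cf i else 0).
  by rewrite coefD coefXn coef_poly.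
have mf : f \is monic.
  by rewrite monicE lead_coefDl ?lead_coefXn // size_polyXn ltnS size_poly.
(* The linear coefficient is a unit because v(p z) = v(z^p); this makes 0 a simple root modulo the
   maximal ideal. *)
have pz : vleb A 1 (p%:R * z / z ^+ p) && vleb A (p%:R * z / z ^+ p) 1.
  rewrite vle_div // vle_divl // !mul1r.
  have [h1 h2] := vle_addr_dom hA (x := - z ^+ p) (y := p%:R * z + z ^+ p) ltac:(by rewrite vlebN).
  have e : - z ^+ p + (p%:R * z + z ^+ p) = p%:R * z by ring.
  rewrite e in h1 h2; rewrite h1 h2 vlebN // vleNb // vleb_refl //.
have [pz1 pz2] := andP pz.
have cA i : vleb A 1 (cf i).
  case: i => [|i]; first by rewrite /cf vle_div // mul1r vlebN // vltW.
  rewrite /cf exprSr -[X in vleb _ _ X]mulrA.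
  have -> : p%:R * ('C(p, i.+1) %/ p)%:R * (z ^+ i * z / z ^+ p) =
    (p%:R * z / z ^+ p) * (('C(p, i.+1) %/ p)%:R * z ^+ i) by ring.
  by apply: (vle1M hA pz1); rewrite vle1M ?vle_nat ?vleb_refl ?vle1X // vltW.
have fA i : f`_i \in A.
  by rewrite -(vle1b hA) fi vlebD ?vle_nat ?vleb_refl //; case: ifP => _; rewrite ?vleb0.
have f0 : f.[0] = - (h - 1) / z ^+ p.
  by rewrite horner_coef0 fi p0 (ltn_eqF p0) add0r.
have f1 : (f^`()).[0] = p%:R * z / z ^+ p.
  by rewrite horner_coef0 coef_deriv fi p1 (ltn_eqF p1) add0r mulr1n /cf bin1 divnn p0 mulr1 expr1.
have A0 : 0 \in A by rewrite -(vle1b hA) vleb0.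
have m0 : maxid A f.[0] by apply/(maxidP hA); rewrite f0 vle_divl // mul1r vleNb.
have u0 : vunit A (f^`()).[0] by apply/(vunitP hA); rewrite f1.
have [b [_ rb _]] := henA mf fA A0 m0 u0.
suff hb : h = (1 + z * b) ^+ p by have := generates_not_pth_power (1 + z * b) hzeta gh; rewrite -hb eqxx.
move: rb; rewrite /root hornerD hornerXn horner_poly => /eqP rb.
have {rb} : z ^+ p * (b ^+ p + \sum_(i < p) cf i * b ^+ i) = 0 by rewrite rb mulr0.
have recl n (G : nat -> K) : (0 < n)%N -> \sum_(i < n) G i = G 0%N + \sum_(i < n.-1) G i.+1.
  by case: n => // n _; rewrite big_ord_recl.
rewrite exp1D_prime // (recl p (fun i => cf i * b ^+ i) p0) => e.
apply/eqP; rewrite -subr_eq0 -oppr_eq0 -[X in _ == X]e; apply/eqP.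
have -> : \sum_(i < p.-1) cf i.+1 * b ^+ i.+1 =
  (p%:R * \sum_(i < p.-1) ('C(p, i.+1) %/ p)%:R * (z * b) ^+ i.+1) / z ^+ p.
  rewrite mulr_sumr mulr_suml; apply: eq_bigr => i _; rewrite /cf exprMn.
  by field.
by rewrite exprMn expr0 /cf; field.
Qed.
End Hensel.
End KummerGenerators.

(** * Best generators and normal forms *)

Section NormalForms.
Variables (p : nat) (K : fieldType) (A : pred K) (z : K).
Hypotheses (pp : prime p) (hA : is_valring A) (hp : ~~ vleb A p%:R 1).
Hypotheses (z0 : z != 0) (hz : ~~ vleb A (p%:R * z + z ^+ p) (z ^+ p)).
Local Notation "x <=v y" := (vleb A x y) (at level 70).
Local Notation "x <v y" := (~~ vleb A y x) (at level 70).
Local Notation k := (residue hA).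

Let p0 := prime_gt0 pp.
Let p1 := prime_gt1 pp.
Let zp0 : z ^+ p != 0. Proof. by rewrite expf_neq0. Qed.
Let z_gt0 : 1 <v z := val_z_gt0 hA pp hp z0 hz.
Let zp_gt0 : 1 <v z ^+ p.
Proof. by rewrite -(expr1n K p) vltb_exp. Qed.
Let pk : p \in [pchar k] := res_pchar hA pp hp.

Lemma vunit_pdivv h : 1 <=v h -> h <=v 1 -> pdivv A p h.
Proof. by move=> h1 h2; exists 1; split; rewrite ?oner_eq0 // expr1n; apply/(veqP hA); rewrite h1 h2. Qed.

Lemma pdivvM x y : pdivv A p y -> x <=v y -> y <=v x -> pdivv A p x.
Proof.
move=> [g [g0 /(veqP hA)/andP[h1 h2]]] xy yx; exists g; split=> //; apply/(veqP hA).
by rewrite (vleb_trans hA xy h1) (vleb_trans hA h2 yx).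
Qed.

Lemma unit_nat_lt i : (0 < i < p)%N -> 1 <=v i%:R /\ i%:R <=v 1.
Proof.
move=> hi; have n1 n : 1 <=v n%:R by rewrite vle_nat ?vleb_refl.
split=> //; apply: contraT => h; have [u [v uv]] := prime_bezout pp hi.
have : 1 <v i%:R * u%:R - p%:R * v%:R by rewrite vltbB ?vlt1M.
by rewrite -!natrM uv natrD addrC addKr vleb_refl.
Qed.

Lemma res_unit_neq0 i : (0 < i < p)%N -> (i%:R : k) != 0.
Proof.
move=> /andP[i0 ip]; rewrite -(dvdn_pcharf pk) gtnNdvd //.
Qed.

Lemma res_nat_exp i : (i%:R : k) ^+ p = i%:R.
Proof. by rewrite -(pFrobenius_autE pk) pFrobenius_aut_nat. Qed.

Lemma one_plus_unit x : 1 <v x -> 1 <=v 1 + x /\ 1 + x <=v 1.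
Proof. by move=> /(vle_addr_dom hA)[h1 h2]; rewrite h1 h2 vleb_refl. Qed.

Lemma vle_mul_unit x c : 1 <=v c -> c <=v 1 ->
  (forall y, (y <=v c * x) = (y <=v x)) * (forall y, (c * x <=v y) = (x <=v y)).
Proof.
move=> c1 c2; have h1 : x <=v c * x by rewrite mulrC vle_mul1 ?vleb_refl.
have h2 : c * x <=v x by rewrite -{2}[x]mul1r vleb_mul ?vleb_refl.
split=> y; apply/idP/idP => h.
- exact: vleb_trans h h2.
- exact: vleb_trans h h1.
- exact: vleb_trans h1 h.
exact: vleb_trans h2 h.
Qed.

(* How some [h^i g^p] can be closer to 1 than [h = 1 + tau]. *)
Lemma improvement_cases tau i g : tau != 0 -> 1 <v tau -> g != 0 -> (0 < i < p)%N ->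
  tau <v (1 + tau) ^+ i * g ^+ p - 1 ->
  (exists r, [/\ r <v z, tau <v r ^+ p - i%:R * tau, r ^+ p <=v tau & tau <=v r ^+ p]) \/
  (z ^+ p <=v tau /\ (tau <=v z ^+ p ->
    exists2 x, 1 <=v x & z ^+ p <v z ^+ p * (x ^+ p - x) - i%:R * tau)).
Proof.
move=> t0 ht g0 hi; set y := _ * g ^+ p => hy.
have [i1 i2] := unit_nat_lt hi.
have [h1 h2] := one_plus_unit ht.
have [y1 y2] : 1 <=v y /\ y <=v 1.
  by have := one_plus_unit (vlt_trans hA ht hy); rewrite subrKC.
have y0 : y != 0 by apply: contraTneq y2 => ->; rewrite vle0b oner_eq0.
(* As y is closer to 1 than 1 + tau, the p-th power (1 + r)^p = (1 + tau)^i / y agrees with 1 + i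
   tau to first order. *)
pose r := g^-1 - 1; have wE : (1 + r) ^+ p = (1 + tau) ^+ i / y.
  rewrite /r subrKC /y exprVn invfM mulrA mulfV ?mul1r //.
  by move: y0; rewrite /y mulf_eq0 negb_or => /andP[].
have w1 : 1 <=v (1 + r) ^+ p by rewrite wE vle1M ?vle1X ?vle1V.
have near : tau <v (1 + r) ^+ p - 1 - i%:R * tau.
  have -> : (1 + r) ^+ p - 1 - i%:R * tau =
    ((1 + tau) ^+ i - 1 - i%:R * tau) - (y - 1) * (1 + r) ^+ p.
    by rewrite wE; field.
  by apply: vltbB => //; [apply: exp1D_val | apply: vlt_mul1].
have near' : i%:R * tau <v (1 + r) ^+ p - 1 - i%:R * tau by rewrite (vle_mul_unit tau i1 i2).
have [d1 d2] := vle_dom hA near'.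
have {}d1 u : (u <=v (1 + r) ^+ p - 1) = (u <=v tau) by rewrite d1 (vle_mul_unit tau i1 i2).
have {}d2 u : ((1 + r) ^+ p - 1 <=v u) = (tau <=v u) by rewrite d2 (vle_mul_unit tau i1 i2).
case: (pth_power_cases hA pp hp z0 hz r) => [[rz hr]|[x x1 [rx hr]]]; [left; exists r | right].
  have [e1 e2] := vle_dom hA hr.
  have e3 : r ^+ p <=v tau by rewrite -d1 e1 vleb_refl.
  have e4 : tau <=v r ^+ p by rewrite -d2 e2 vleb_refl.
  split=> //; have -> : r ^+ p - i%:R * tau =
    ((1 + r) ^+ p - 1 - i%:R * tau) - ((1 + r) ^+ p - 1 - r ^+ p) by ring.
  by apply: vltbB => //; apply: vle_lt_trans hr.
have zt : z ^+ p <=v tau.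
  by rewrite -d1 val_pth_power_big // rx -{1}[z]mul1r vleb_mulr.
split=> // tz; exists x => //.
have -> : z ^+ p * (x ^+ p - x) - i%:R * tau =
  ((1 + r) ^+ p - 1 - i%:R * tau) - ((1 + r) ^+ p - 1 - z ^+ p * (x ^+ p - x)) by ring.
by apply: vltbB => //; apply: vle_lt_trans near.
Qed.

(** The disjunction is inclusive; [normal_form_exactly_one] recovers exclusivity. *)
Definition normal_form h :=
  [\/ prop_i A p h, prop_ii A p h, prop_iii A p z h | prop_iv A p z h \/ prop_v A p z h].

Lemma vlt_scale u x : u != 0 -> (u <v u * x) = (1 <v x).
Proof. by move=> u0; rewrite -{2}[u]mulr1 vleb_mull. Qed.

(** In cases (i) and (ii) a strict improvement makes h^i g^p a unit congruent to 1, so h^i, and then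
    h, is a p-th power in value or in residue. In the other cases [improvement_cases] contradicts
    the condition on t, u or c. *)
Lemma normal_form_best h i g : h != 0 -> h \in A -> normal_form h -> g != 0 -> (0 < i < p)%N ->
  h ^+ i * g ^+ p - 1 <=v h - 1.
Proof.
move=> h0 hh nf g0 hi; apply: contraT => hy; have [i1 i2] := unit_nat_lt hi.
have [i0 _] := andP hi; rewrite -(vle1b hA) in hh.
have g0' := invr_neq0 g0.
have yunit : 1 <=v h - 1 -> [/\ 1 <=v h ^+ i * g ^+ p & h ^+ i * g ^+ p <=v 1].
  by move=> h1; have [] := one_plus_unit (vle_lt_trans hA h1 hy); rewrite subrKC.
have ik := res_unit_neq0 hi.
have tau_case tau : h = 1 + tau -> tau != 0 -> 1 <v tau ->
  (exists r, [/\ r <v z, tau <v r ^+ p - i%:R * tau, r ^+ p <=v tau & tau <=v r ^+ p]) \/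
  (z ^+ p <=v tau /\ (tau <=v z ^+ p ->
    exists2 x, 1 <=v x & z ^+ p <v z ^+ p * (x ^+ p - x) - i%:R * tau)).
  move=> hE t0 t1; apply: (@improvement_cases tau i g) => //; move: hy; rewrite hE.
  by have -> : 1 + tau - 1 = tau by ring.
case: nf => [nd|[/(vunitP hA)/andP[h1 h2] nr]
  |[c [t [/(vunitP hA)/andP[c1 c2] /(maxidP hA) t1 hE /(vltP hA) tz nd]]]
  |[[u [s [/(vunitP hA)/andP[u1 u2] nr /(maxidP hA) s1 hE /(vltP hA) sz]]]
  |[c [/(vunitP hA)/andP[c1 c2] hE nr]]]].
- have [|y1 y2] := yunit; first by rewrite vlebB ?vleb_refl.
  case: nd; apply: (pdivv_exp hA pp hi h0); exists g^-1; split=> //; apply/(veqP hA).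
  by rewrite exprVn -[_^-1]mul1r vle_div ?vle_divl ?expf_neq0 // y1 y2.
- have hy1 : 1 <v h ^+ i * g ^+ p - 1.
    by apply: vle_lt_trans hy; rewrite // vlebB ?vleb_refl.
  have [|y1 y2] := yunit; first by rewrite vlebB ?vleb_refl.
  case: nr; apply/(res_ppowP hA p h1).
  have gi1 : 1 <=v g^-1.
    rewrite vle1V // -(vlex1_exp hA _ p0); apply: vleb_trans y2 => //.
    by rewrite mulrC vle_mul1 ?vleb_refl ?vle1X.
  have gi2 : 1 <=v g.
    rewrite -(vle1_exp hA _ p0); apply: (vleb_trans hA y1).
    by rewrite -{2}[g ^+ p]mul1r vleb_mul ?vleb_refl // vlex1X.
  have e : res hA h ^+ i * res hA g ^+ p = 1.
    by rewrite -!resX // -resM ?vle1X // -(res1 hA); apply/(resE hA); rewrite ?vleb_refl.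
  have [u [v uv]] := prime_bezout pp hi.
  have rg0 : res hA g != 0.
    apply: contra_eqN e => /eqP->; rewrite expr0n gtn_eqF // mulr0 eq_sym; exact: oner_neq0.
  have rh0 : res hA h != 0 by rewrite res_eq0 // negbK.
  (* With i u = p v + 1 and g^p = h^-i in k, the p-th power of this element is h^(i u) / h^(p v) =
     h. *)
  exists (res hA g ^- u / res hA h ^+ v).
  rewrite expr_div_n exprVn -!exprM mulnC exprM -exprVn.
  have -> : (res hA g ^+ p)^-1 = res hA h ^+ i.
    by rewrite -[LHS]mul1r -e mulfK // expf_neq0.
  by rewrite -exprM uv addn1 exprS [(v * p)%N]mulnC mulfK // expf_neq0.
- have t0 := vlt_neq0 tz.
  have [e1 e2] := vle_mul_unit t c1 c2.
  have ct0 : c * t != 0.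
    by rewrite mulf_neq0 //; apply: contraTneq c2 => ->; rewrite vle0b oner_eq0.
  have [|[r [rz _ r1 r2]]|[zt _]] := tau_case _ hE ct0; first by rewrite e2.
    case: nd; apply: (pdivvM (y := r ^+ p)); rewrite -?e1 -?e2 //.
    exists r; split; last by apply/(veqP hA); rewrite vleb_refl.
    exact: vlt_neq0 rz.
  by rewrite e1 (negPf tz) in zt.
- have s0 := vlt_neq0 sz.
  have sp0 : s ^+ p != 0 by rewrite expf_neq0.
  have [e1 e2] := vle_mul_unit (s ^+ p) u1 u2.
  have us0 : u * s ^+ p != 0.
    by rewrite mulf_neq0 //; apply: contraTneq u2 => ->; rewrite vle0b oner_eq0.
  have [|[r [rz r3 r1 r2]]|[zt _]] := tau_case _ hE us0.
  - by rewrite e2 -(expr1n K p) vltb_exp.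
  - case: nr; apply/(res_ppowP hA p u1).
    have rs1 : 1 <=v r / s.
      by rewrite -(vle1_exp hA _ p0) expr_div_n vle_div // mul1r -e2.
    (* In k one has (r / s)^p = i u and i = i^p, so dividing by i stays among p-th powers. *)
    exists (res hA (r / s) / i%:R).
    rewrite expr_div_n res_nat_exp; apply: (canRL (mulfK ik)).
    rewrite -(res_nat hA) -resM // -resX //; apply/esym/(resE hA); [exact: vle1X|exact: vle1M|].
    rewrite -(vlt_scale _ sp0).
    have -> : s ^+ p * ((r / s) ^+ p - u * i%:R) = r ^+ p - i%:R * (u * s ^+ p).
      by rewrite expr_div_n; field.
    by apply: vle_lt_trans r3; rewrite // e1 vleb_refl.
  by rewrite e1 (vle_pexp hA _ _ p0) (negPf sz) in zt.
have [e1 e2] := vle_mul_unit (z ^+ p) c1 c2.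
have cz0 : c * z ^+ p != 0.
  by rewrite mulf_neq0 //; apply: contraTneq c2 => ->; rewrite vle0b oner_eq0.
have [|[r [rz r3 r1 r2]]|[zt]] := tau_case _ hE cz0; first by rewrite e2.
  by move: r2; rewrite e2 (negPf (vltb_exp hA p0 rz)).
case=> [|x x1 hx]; first by rewrite e2 vleb_refl.
(* In k one has x^p - x = i c, and i^p = i gives c = (x / i)^p - x / i. *)
case: nr; apply/(res_ASP hA p c1); exists (res hA x / i%:R).
rewrite expr_div_n res_nat_exp -mulrBl; apply: (canRL (mulfK ik)).
rewrite -(res_nat hA) -resM // -resX // -(resB hA (vle1X hA p x1) x1).
apply/esym/(resE hA); rewrite ?vle1M ?(vlebB hA (vle1X hA p x1) x1) //.
rewrite -(vlt_scale _ zp0); apply: contra hx.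
by have -> : z ^+ p * (x ^+ p - x - c * i%:R) =
  z ^+ p * (x ^+ p - x) - i%:R * (c * z ^+ p) by ring.
Qed.

(** Properties (iii) to (v) force h to be congruent to 1, which excludes (i) and (ii). Among
    themselves they are separated by v(h - 1): below v(z^p) and not divisible by p, below v(z^p) and
    divisible by p, equal to v(z^p). *)
Lemma normal_form_exactly_one h : normal_form h ->
  exactly_one [:: prop_i A p h; prop_ii A p h; prop_iii A p z h; prop_iv A p z h; prop_v A p z h].
Proof.
pose near := 1 <v h - 1.
have n3 : prop_iii A p z h -> near.
  move=> [c [t [/(vunitP hA)/andP[c1 c2] /(maxidP hA) t1 hE _ _]]].
  by rewrite /near hE addrC addKr (vle_mul_unit t c1 c2).
have n4 : prop_iv A p z h -> near.
  move=> [c [t [/(vunitP hA)/andP[c1 c2] _ /(maxidP hA) t1 hE _]]].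
  by rewrite /near hE addrC addKr (vle_mul_unit _ c1 c2) -(expr1n K p) vltb_exp.
have n5 : prop_v A p z h -> near.
  move=> [c [/(vunitP hA)/andP[c1 c2] hE _]].
  by rewrite /near hE addrC addKr (vle_mul_unit _ c1 c2).
have ni : near -> ~ prop_i A p h.
  move=> /one_plus_unit; rewrite subrKC => -[h1 h2]; apply; exact: vunit_pdivv.
have nii : near -> ~ prop_ii A p h.
  move=> nh [_]; apply; exists 1; first by rewrite -vle1b ?vleb_refl.
  by rewrite expr1n; apply/(maxidP hA).
have n12 : prop_i A p h -> ~ prop_ii A p h.
  by move=> nd [/(vunitP hA)/andP[h1 h2] _]; apply: nd; apply: vunit_pdivv.
have n34 : prop_iii A p z h -> ~ prop_iv A p z h.
  move=> [c [t [/(vunitP hA)/andP[c1 c2] _ hE _ nd]]].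
  move=> [u [s [/(vunitP hA)/andP[u1 u2] _ _ hE' /(vltP hA) sz]]].
  have e : c * t = u * s ^+ p by apply: (addrI 1); rewrite -hE hE'.
  have [e1 e2] := vle_mul_unit t c1 c2; have [e3 e4] := vle_mul_unit (s ^+ p) u1 u2.
  apply: nd; exists s; split; first exact: vlt_neq0 sz.
  by apply/(veqP hA); rewrite -e1 -e2 e e3 e4 vleb_refl.
have n35 : prop_iii A p z h -> ~ prop_v A p z h.
  move=> [c [t [/(vunitP hA)/andP[c1 c2] _ hE /(vltP hA) tz nd]]].
  move=> [u [/(vunitP hA)/andP[u1 u2] hE' _]].
  have e : c * t = u * z ^+ p by apply: (addrI 1); rewrite -hE hE'.
  have [e1 e2] := vle_mul_unit t c1 c2; have [e3 e4] := vle_mul_unit (z ^+ p) u1 u2.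
  by move: tz; rewrite -e1 e e3 vleb_refl.
have n45 : prop_iv A p z h -> ~ prop_v A p z h.
  move=> [c [s [/(vunitP hA)/andP[c1 c2] _ _ hE /(vltP hA) sz]]].
  move=> [u [/(vunitP hA)/andP[u1 u2] hE' _]].
  have e : c * s ^+ p = u * z ^+ p by apply: (addrI 1); rewrite -hE hE'.
  have [e1 e2] := vle_mul_unit (s ^+ p) c1 c2; have [e3 e4] := vle_mul_unit (z ^+ p) u1 u2.
  by move: (vltb_exp hA p0 sz); rewrite -e1 e e3 vleb_refl.
rewrite /normal_form /=; move: ni nii n3 n4 n5 n12 n34 n35 n45.
move: (is_true near) (prop_i A p h) (prop_ii A p h) (prop_iii A p z h) (prop_iv A p z h) (prop_v A p z h).
by move=> N P1 P2 P3 P4 P5 ? ? ? ? ? ? ? ? ? [?|?|?|?]; tauto.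
Qed.

Lemma exactly_one_normal_form h :
  exactly_one [:: prop_i A p h; prop_ii A p h; prop_iii A p z h; prop_iv A p z h; prop_v A p z h] ->
  normal_form h.
Proof.
rewrite /normal_form /=.
by move=> [[?]|[_ [[?]|[_ [[?]|[_ [[?]|[_ [[?]|[]//]]]]]]]]] _;
  [constructor 1|constructor 2|constructor 3|constructor 4; left|constructor 4; right].
Qed.
End NormalForms.

(** * Best generators, normal forms and defect of L/K *)

Section Kummer.
Variables (p : nat) (K : fieldType) (L : fieldExtType K) (A : pred K) (zeta z : K).
Hypotheses (pp : prime p) (dimL : \dim {:L} = p).
Hypotheses (hA : is_valring A) (henA : henselian A) (hzeta : p.-primitive_root zeta).
Hypotheses (hp : ~~ vleb A p%:R 1) (pn0 : p%:R != 0 :> K).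
Hypothesis zE : z = zeta - 1.
Local Notation "x <=v y" := (vleb A x y) (at level 70).
Local Notation "x <v y" := (~~ vleb A y x) (at level 70).

Let p0 := prime_gt0 pp.
Let p1 := prime_gt1 pp.
Let z0 : z != 0. Proof. by rewrite zE; case: (prim_root_sub1_val hA pp hp pn0 hzeta). Qed.
Let hz : z ^+ p <v p%:R * z + z ^+ p.
Proof. by rewrite zE; case: (prim_root_sub1_val hA pp hp pn0 hzeta). Qed.
Let zp0 : z ^+ p != 0. Proof. by rewrite expf_neq0. Qed.
Let z_gt0 : 1 <v z := val_z_gt0 hA pp hp z0 hz.

Lemma generates_neq1 h : generates L p h -> h - 1 != 0.
Proof.
by move=> gh; rewrite subr_eq0; have := generates_not_pth_power pp dimL 1 hzeta gh; rewrite expr1n.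
Qed.

Lemma res_ppow_unit u : 1 <=v u -> u <=v 1 -> res_ppow A p u ->
  exists x, [/\ 1 <=v x, x <=v 1 & 1 <v u - x ^+ p].
Proof.
move=> u1 u2 [x xA /(maxidP hA) h]; rewrite -(vle1b hA) in xA; exists x; split=> //.
rewrite -(vlex1_exp hA _ p0); apply: contraT => hx.
by have := vltbD hA h hx; rewrite subrK u2.
Qed.

(** If p does not divide v(h), then h or h^-1 is integral and satisfies (i). Otherwise a p-th power
    factor makes h a unit; its residue either is not a p-th power, which is (ii), or can be
    normalized to 1. *)
Lemma generates_unit_reduction h : generates L p h ->
  (exists h', [/\ h' \in A, generates L p h' & normal_form p A z h']) \/
  exists g, [/\ g != 0, 1 <v h * g ^+ p - 1 & generates L p (h * g ^+ p)].
Proof.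
move=> gh; have h0 := generates_neq0 pp dimL gh.
have [[g [g0 /(veqP hA)/andP[h1 h2]]]|nd] := pselect (pdivv A p h); last first.
  left; have : (1 <=v h) || (1 <=v h^-1) by rewrite vle1V // vleb_total.
  case/orP=> hA1; [exists h | exists h^-1]; split; rewrite -?vle1b //; try by constructor 1.
    exact: generates_inv.
  constructor 1 => -[g [g0 /(veqP hA)/andP[h1 h2]]]; apply: nd.
  exists g^-1; rewrite invr_eq0; split=> //; apply/(veqP hA).
  by rewrite exprVn -[h]invrK !vleV ?expf_neq0 ?invr_eq0 // h1 h2.
pose u := h * (g^-1) ^+ p; have gV0 : g^-1 != 0 by rewrite invr_eq0.
have u1 : 1 <=v u by rewrite /u exprVn vle_div ?expf_neq0 // mul1r.
have u2 : u <=v 1 by rewrite /u exprVn vle_divl ?expf_neq0 // mul1r.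
have gu : generates L p u by apply: generates_mul.
have [/(res_ppow_unit u1 u2)[x [x1 x2 ux]]|nr] := pselect (res_ppow A p u); last first.
  left; exists u; split; rewrite -?vle1b //; constructor 2; split=> //.
  by apply/(vunitP hA); rewrite u1 u2.
have x0 : x != 0 by apply: contraTneq x2 => ->; rewrite vle0b oner_eq0.
right; exists (g^-1 / x); split; first by rewrite mulf_neq0 ?invr_eq0.
  have -> : h * (g^-1 / x) ^+ p - 1 = (u - x ^+ p) * (x^-1) ^+ p.
    by rewrite /u exprMn mulrBl -mulrA -[x ^+ p * _]exprMn mulfV // expr1n.
  by rewrite vlt1M // vle1X // vle1V.
by apply: generates_mul => //; rewrite mulf_neq0 ?invr_eq0.
Qed.

(** When the reduction gives no normal form, bestness forces h = 1 + t with v(t) > 0. Outside the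
    normal forms, t is u s^p or c z^p, where the residue of u is some x^p or that of c some x^p - x.
    Then (1 + x s)^p or (1 + x z)^p agrees with h beyond v(t), and dividing h by it contradicts
    bestness. *)
Lemma best_normal_form h : best L A p h ->
  exists h', [/\ h' \in A, generates L p h' & normal_form p A z h'].
Proof.
move=> [gh hbest].
have [//|[g [g0 hg _]]] := generates_unit_reduction gh.
have best1 g' : g' != 0 -> h * g' ^+ p - 1 <=v h - 1.
  move=> g'0; apply/(vleP hA); rewrite -{1}[h]expr1; apply: hbest => //.
  by rewrite /= -ltnS prednK.
pose t := h - 1; have t1 : 1 <v t by apply: (vlt_le_trans hA hg); apply: best1.
have hE : h = 1 + t by rewrite /t subrKC.
have t0 : t != 0 := generates_neq1 gh.
have tz : t <=v z ^+ p by rewrite zE; apply: (generates_val_le pp dimL hA henA).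
have hA1 : h \in A by rewrite -(vle1b hA) hE vlebD ?vleb_refl // vltW.
have improve rho : 1 <v rho -> t <v h - (1 + rho) ^+ p -> False.
  move=> r1 hr; have [e1 e2] := one_plus_unit hA r1.
  have r0 : 1 + rho != 0 by apply: contraTneq e2 => ->; rewrite vle0b oner_eq0.
  have := best1 (1 + rho)^-1; rewrite invr_eq0 => /(_ r0); apply/negP.
  have -> : h * (1 + rho)^-1 ^+ p - 1 = (h - (1 + rho) ^+ p) * (1 + rho)^-1 ^+ p.
    by rewrite mulrBl -exprMn mulfV // expr1n.
  by rewrite vlt_mul1 // vle1X // vle1V.
exists h; split=> //; apply: contrapT => nf.
have unit1 : vunit A 1 by apply/(vunitP hA); rewrite vleb_refl.
case/boolP: (z ^+ p <=v t) => zt.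
  pose c := t / z ^+ p; have cz : c * z ^+ p = t by rewrite divfK.
  have c1 : 1 <=v c by rewrite vle_div // mul1r.
  have c2 : c <=v 1 by rewrite vle_divl // mul1r.
  have [[x xA /(maxidP hA) cx]|nr] := pselect (res_AS A p c); last first.
    apply: nf; constructor 4; right; exists c; split=> //; last by rewrite cz.
    by apply/(vunitP hA); rewrite c1.
  rewrite -(vle1b hA) in xA; apply: (improve (x * z)); first by rewrite mulrC vlt1M.
  have -> : h - (1 + x * z) ^+ p = z ^+ p * (c - (x ^+ p - x)) -
      ((1 + x * z) ^+ p - 1 - z ^+ p * (x ^+ p - x)).
    by rewrite hE -cz; ring.
  apply: (vle_lt_trans hA tz); apply: vltbB => //; first by rewrite vlt_scale.
  exact: val_pth_power_ge.
have [[s [s0 /(veqP hA)/andP[ts st]]]|nd] := pselect (pdivv A p t); last first.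
  apply: nf; constructor 3; exists 1, t; split; rewrite ?mul1r //; first exact/(maxidP hA).
  exact/(vltP hA).
have sp0 : s ^+ p != 0 by rewrite expf_neq0.
pose u := t / s ^+ p; have us : u * s ^+ p = t by rewrite divfK.
have u1 : 1 <=v u by rewrite vle_div // mul1r.
have u2 : u <=v 1 by rewrite vle_divl // mul1r.
have sz : s <v z.
  by rewrite -(vle_pexp hA _ _ p0); apply: contra zt => h1; apply: (vleb_trans hA h1).
have s1 : 1 <v s.
  by rewrite -(vlex1_exp hA _ p0); apply: contra t1 => h1; apply: (vleb_trans hA ts).
have [/(res_ppow_unit u1 u2)[x [x1 x2 ux]]|nr] := pselect (res_ppow A p u); last first.
  apply: nf; constructor 4; left; exists u, s; split; rewrite ?us //.
  - by apply/(vunitP hA); rewrite u1.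
  - exact/(maxidP hA).
  exact/(vltP hA).
apply: (improve (x * s)); first by rewrite mulrC vlt1M.
have -> : h - (1 + x * s) ^+ p = s ^+ p * (u - x ^+ p) -
    ((1 + x * s) ^+ p - 1 - (x * s) ^+ p).
  by rewrite hE -us exprMn; ring.
apply: (vle_lt_trans hA ts); apply: vltbB => //; first by rewrite vlt_scale.
have [e1 e2] := vle_mul_unit hA (s ^+ p) (vle1X hA p x1) (vlex1X hA p x2).
have xs : x * s <v z by rewrite (vle_mul_unit hA s x1 x2).
apply: (vle_lt_trans hA _ (val_pth_power_lt hA pp hp z0 hz xs)).
by rewrite exprMn e1 vleb_refl.
Qed.

Section Extension.
Variable B : pred L.
Hypothesis hAB : extends_val A B.
Let hB : is_valring B := hAB.1.

Let hpB : ~~ vleb B p%:R 1.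
Proof. have -> : (p%:R : L) = (p%:R)%:A by rewrite scaler_nat. by rewrite (vle_ext1r hAB). Qed.
Let zB0 : (z%:A : L) != 0. Proof. by rewrite alg_neq0. Qed.
Let hzB : ~~ vleb B (p%:R * z%:A + z%:A ^+ p) (z%:A ^+ p).
Proof.
have -> : (p%:R : L) = (p%:R)%:A by rewrite scaler_nat.
by rewrite -alg_mul -alg_exp -scalerDl (vle_ext hAB).
Qed.

(** The position of r = alpha - 1 is read off v(h - 1). A value below v(z^p) excludes v(r) >= v(z),
    so r^p agrees with h - 1 to first order; the value v(z^p) excludes v(r) < v(z), so r = x z with
    x integral and x^p - x congruent to c. *)
Lemma normal_form_ramified_or_inertial h : h != 0 -> generates L p h -> normal_form p A z h ->
  (ram_index B p /\ res_degree A B 1) \/ (ram_index B 1 /\ res_degree A B p).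
Proof.
move=> h0 gh; have /(generatesP pp dimL)[alpha ah _] := gh.
have inert (eps : bool) c gamma : 1 <=v c -> vleb B 1 gamma ->
    ~~ vleb B (gamma ^+ p - eps%:R * gamma - c%:A) 1 ->
    (forall x, 1 <=v x -> x ^+ p - eps%:R * x - c <=v 1) ->
    (ram_index B p /\ res_degree A B 1) \/ (ram_index B 1 /\ res_degree A B p).
  move=> c1 g1 hg hc; right; apply: (inertial_defectless hA hAB p0 dimL).
  exact: (res_indep_root hA hAB pp hp c1 g1 hg hc).
have aE : alpha = 1 + (alpha - 1) by rewrite subrKC.
case=> [nd|[/(vunitP hA)/andP[h1 h2] nr]
  |[c [t [/(vunitP hA)/andP[c1 c2] /(maxidP hA) t1 hE /(vltP hA) tz nd]]]
  |[[u [s [/(vunitP hA)/andP[u1 u2] nr /(maxidP hA) s1 hE /(vltP hA) sz]]]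
  |[c [/(vunitP hA)/andP[c1 c2] hE nr]]]].
- left; apply: (ramified_defectless hA hAB pp dimL h0 nd (gamma := alpha)).
  by apply/(veqP hB); rewrite ah vleb_refl.
- apply: (inert false h alpha) => //.
  + by rewrite -(vle1_exp hB _ p0) ah (vle_ext1 hAB).
  + by rewrite mul0r subr0 ah subrr vltb0 oner_eq0.
  move=> x x1; apply: contraT => hx; case: nr; exists x; first by rewrite -vle1b.
  by apply/(maxidP hA); rewrite -opprB vleNb //; move: hx; rewrite mul0r subr0.
- pose r := alpha - 1; have rE : (1 + r) ^+ p - 1 = (c * t)%:A.
    by rewrite /r -aE ah hE scalerDl scale1r addrC addKr.
  have [e1 e2] := vle_mul_unit hA t c1 c2.
  have rz : ~~ vleb B z%:A r.
    apply: contraL (tz) => zr; rewrite negbK -(e1 (z ^+ p)) -(vle_ext hAB) alg_exp -rE.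
    exact: val_pth_power_big.
  have [d1 d2] := val_pth_power_small hB pp hpB zB0 hzB rz.
  rewrite rE in d1 d2.
  left; apply: (ramified_defectless hA hAB pp dimL (vlt_neq0 tz) nd (gamma := r)).
  by apply/(veqP hB); rewrite -d1 -d2 !(vle_ext hAB) e1 e2 vleb_refl.
- pose r := alpha - 1; have rE : (1 + r) ^+ p - 1 = (u * s ^+ p)%:A.
    by rewrite /r -aE ah hE scalerDl scale1r addrC addKr.
  have [e1 e2] := vle_mul_unit hA (s ^+ p) u1 u2.
  have s0 := vlt_neq0 sz; have sp0 : s ^+ p != 0 by rewrite expf_neq0.
  have spB : s%:A ^+ p != 0 :> L by rewrite -alg_exp alg_neq0.
  have rz : ~~ vleb B z%:A r.
    apply: contraL (sz) => zr; rewrite negbK -(vle_pexp hA _ _ p0) -e1 -(vle_ext hAB) alg_exp -rE.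
    exact: val_pth_power_big.
  have hr := val_pth_power_lt hB pp hpB zB0 hzB rz.
  have [d1 d2] := vle_dom hB hr; rewrite rE in hr d1 d2.
  apply: (inert false u (r / s%:A)) => //.
  + rewrite -(vle1_exp hB _ p0) expr_div_n vle_div // mul1r -d1 -alg_exp (vle_ext hAB).
    by rewrite e1 vleb_refl.
  + rewrite mul0r subr0 -(vleb_mulr B _ _ spB) mul1r mulrBl expr_div_n divfK //.
    rewrite -alg_exp -alg_mul -opprB vleNb //; apply: vle_lt_trans hr => //.
    by rewrite -d1 (vle_ext hAB) e1 vleb_refl.
  move=> x x1; apply: contraT => hx; case: nr; exists x; first by rewrite -vle1b.
  by apply/(maxidP hA); rewrite -opprB vleNb //; move: hx; rewrite mul0r subr0.
pose r := alpha - 1; have rE : (1 + r) ^+ p - 1 = (c * z ^+ p)%:A.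
  by rewrite /r -aE ah hE scalerDl scale1r addrC addKr.
have [e1 e2] := vle_mul_unit hA (z ^+ p) c1 c2.
have zpB : z%:A ^+ p != 0 :> L by rewrite -alg_exp alg_neq0.
case: (pth_power_cases hB pp hpB zB0 hzB r) => [[rz hr]|[x x1 [rx hr]]].
  have [d1 d2] := vle_dom hB hr; have := vltb_exp hB p0 rz.
  by rewrite -d1 rE -alg_exp (vle_ext hAB) e1 vleb_refl.
apply: (inert true c x) => //.
  rewrite mul1r -(vlt_scale B _ zpB) -vleNb //; apply: contra hr; rewrite rE.
  by have -> : (c * z ^+ p)%:A - z%:A ^+ p * (x ^+ p - x) = - (z%:A ^+ p * (x ^+ p - x - c%:A));
    first by rewrite alg_mul alg_exp; ring.
move=> y y1; apply: contraT => hx; case: nr; exists y; first by rewrite -vle1b.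
by apply/(maxidP hA); rewrite -opprB vleNb //; move: hx; rewrite mul1r.
Qed.
(* For [c] a best approximation of [alpha], the generator [h / c^p] is best:
   a strictly better [h'^i g^p] would yield, after extracting p-th roots, a
   constant strictly closer to [alpha]. *)
Lemma defectless_best h0 e f : generates L p h0 ->
  ram_index B e -> res_degree A B f -> \dim {:L} = (e * f)%N ->
  (exists h, [/\ h \in A, generates L p h & normal_form p A z h]) \/ exists h, best L A p h.
Proof.
move=> gh0 [x [x0 hx _]] [b [bB hb _]] dimE.
have [nf|[g1 [g10 hm gh]]] := generates_unit_reduction gh0; [by left | right].
set h := h0 * g1 ^+ p in hm gh.
have [alpha ah nc] := (generatesP pp dimL h).1 gh.
have vind := standard_val_indep hA hAB x0 hx (conj bB hb).
have cI : #|{: 'I_e * 'I_f}| = \dim {:L} by rewrite card_prod !card_ord dimE.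
have [c hc] := best_approximation hA hAB alpha vind cI.
(* Since v(z) > 0, v(alpha - 1) <= 0 would give v(h - 1) = v((alpha - 1)^p) <= 0. *)
have alpha1 : ~~ vleb B (alpha - 1) 1.
  apply/negP => ha1.
  have ha2 : ~~ vleb B z%:A (alpha - 1).
    by apply: (vle_lt_trans hB ha1); rewrite (vle_ext1r hAB).
  have [_ d2] := val_pth_power_small hB pp hpB zB0 hzB ha2.
  have := d2 1; rewrite subrKC ah (vlex1_exp hB _ p0) ha1 -[X in _ - X]scale1r -scalerBl.
  by rewrite (vle_ext1r hAB) (negPf hm).
have alphac : ~~ vleb B (alpha - c%:A) 1.
  by apply: (vlt_le_trans hB alpha1); have := hc 1; rewrite scale1r.
have [c1 c2] : 1 <=v c /\ c <=v 1.
  have := @one_plus_unit _ _ hA (c - 1); rewrite subrKC; apply.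
  rewrite -(vle_ext1r hAB) scalerBl scale1r.
  have -> : c%:A - 1 = (alpha - 1) - (alpha - c%:A) by ring.
  exact: vltbB.
have c0 : c != 0 by apply: contraTneq c2 => ->; rewrite vle0b oner_eq0.
have cB0 : c%:A != 0 :> L by rewrite alg_neq0.
pose h' := h * c^-1 ^+ p; pose r := alpha / c%:A - 1.
have gh' : generates L p h' by apply: generates_mul; rewrite ?invr_eq0.
have h'0 := generates_neq0 pp dimL gh'.
have rho_p : (1 + r) ^+ p = h'%:A.
  by rewrite /r subrKC expr_div_n ah /h' alg_mul alg_exp alg_inv exprVn.
have rc : r = (alpha - c%:A) / c%:A by rewrite mulrBl divff.
have r0 : r != 0 by rewrite rc mulf_neq0 ?invr_eq0 // subr_eq0.
have r1 : ~~ vleb B r 1.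
  by rewrite rc vlt1M // vle1V // (vle_ext1r hAB).
have sub1 (u : K) : u%:A - 1 = (u - 1)%:A :> L by rewrite scalerBl scale1r.
exists h'; split=> // g i g0 hi; apply/(vleP hA); apply: contraT => hlt.
have {}hi : (0 < i < p)%N by case/andP: hi => i0 ip; rewrite i0 -(prednK p0) ltnS.
set h'' := h' ^+ i * g ^+ p in hlt.
have gh'' : generates L p h'' by apply: generates_exp_mul.
(* The Hensel bound on the hypothetical improvement yields v(h' - 1) < v(z^p), which places r where
   (1 + r)^p - 1 has the value of r^p. *)
have hle : h'' - 1 <=v z ^+ p by rewrite zE; apply: (generates_val_le pp dimL hA henA).
have rz : ~~ vleb B z%:A r.
  apply: contra (vlt_le_trans hA hlt hle) => zr.
  by have := val_pth_power_big hB pp hpB zB0 hzB zr; rewrite rho_p sub1 -alg_exp (vle_ext hAB).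
have [d1 d2] := val_pth_power_small hB pp hpB zB0 hzB rz; rewrite rho_p sub1 in d1 d2.
have h'1 : 1 <v h' - 1 by rewrite -(vle_ext1r hAB) d2 (vlex1_exp hB _ p0).
have [u1 u2] : 1 <=v h' /\ h' <=v 1.
  by have := @one_plus_unit _ _ hA (h' - 1); rewrite subrKC; apply.
have [u3 u4] : 1 <=v h'' /\ h'' <=v 1.
  by have := one_plus_unit hA (vlt_trans hA h'1 hlt); rewrite subrKC.
(* [1 + q] is a p-th root of [h'']; if v(q) <= v(r), then v(h'' - 1) = v(q^p) <= v(r^p) = v(h' - 1),
   against the improvement. *)
pose q := (1 + r) ^+ i * g%:A - 1.
have qp : (1 + q) ^+ p = h''%:A.
  by rewrite /q subrKC exprMn -exprM mulnC exprM rho_p /h'' alg_mul !alg_exp.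
have rq : ~~ vleb B q r.
  apply/negP => qr; have qz := vle_lt_trans hB qr rz.
  have [d3 d4] := val_pth_power_small hB pp hpB zB0 hzB qz; rewrite qp sub1 in d3 d4.
  move/negP: hlt; apply; rewrite -(vle_ext hAB) d1 d4; exact: vleb_exp.
have w1 : 1 <=v g^-1.
  rewrite vle1V // -(vlex1_exp hA _ p0); apply: (vleb_trans hA _ u4).
  by rewrite /h'' mulrC vle_mul1 ?vleb_refl ?vle1X.
have gB0 : g%:A != 0 :> L by rewrite alg_neq0.
have wq : ~~ vleb B ((1 + r) ^+ i - (g^-1)%:A) r.
  have -> : (1 + r) ^+ i - (g^-1)%:A = q * (g^-1)%:A.
    by rewrite /q alg_inv mulrBl mulfK // mul1r.
  by apply: vlt_mul1; rewrite // (vle_ext1 hAB).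
have [i1 i2] := unit_nat_lt pp hA hp hi.
have iK0 : (i%:R : K) != 0 by apply: contraTneq i2 => ->; rewrite vle0b oner_eq0.
have iE : (i%:R : L) = (i%:R)%:A by rewrite scaler_nat.
have iB0 : (i%:R : L) != 0 by rewrite iE alg_neq0.
(* First-order solution of (1 + d)^i = g^-1. As (1 + r)^i is close to g^-1 and i is a unit, v(r - d)
   > v(r), so c (1 + d) approximates alpha better than c. *)
pose d := (g^-1 - 1) / i%:R.
have dE : d%:A = ((g^-1)%:A - 1) / i%:R :> L by rewrite alg_mul alg_inv iE sub1.
have rd : ~~ vleb B (r - d%:A) r.
  have -> : r - d%:A = (((1 + r) ^+ i - (g^-1)%:A) - ((1 + r) ^+ i - 1 - i%:R * r)) / i%:R.
    by rewrite dE; field.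
  apply: vlt_mul1 => //; last by rewrite vle1V // iE (vle_ext1r hAB).
  by apply: vltbB => //; apply: exp1D_val.
have := hc (c * (1 + d)).
have -> : alpha - (c * (1 + d))%:A = c%:A * (r - d%:A).
  by rewrite rc alg_mul scalerDl scale1r; field.
have -> : alpha - c%:A = c%:A * r by rewrite rc mulrCA mulfV // mulr1.
by rewrite vleb_mull // (negPf rd).
Qed.

End Extension.

Lemma normal_form_defectless h : generates L p h -> normal_form p A z h -> defectless L A.
Proof.
move=> gh nf B hAB.
have [[h1 h2]|[h1 h2]] := normal_form_ramified_or_inertial hAB (generates_neq0 pp dimL gh) gh nf.
  by exists p, 1%N; rewrite muln1.
by exists 1%N, p; rewrite mul1n.
Qed.

(** [defectless] quantifies over all extensions of the valuation ring, so one of them has to be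
    exhibited before e and f can be extracted. *)
Lemma defectless_normal_form h0 : generates L p h0 -> defectless L A ->
  exists h, [/\ h \in A, generates L p h & normal_form p A z h].
Proof.
move=> gh0 dl; have [B hAB] := valring_extension L hA; have [e [f [he hf dimE]]] := dl B hAB.
by have [//|[h /best_normal_form]] := defectless_best hAB gh0 he hf dimE.
Qed.

End Kummer.

Theorem theorem3p3p3 (p : nat) (K : fieldType) (L : fieldExtType K) (A : pred K)
    (zeta : K) :
  prime p ->
  is_valring A -> henselian A -> (exists x : K, x \notin A) ->
  [pchar K] =i pred0 -> maxid A (p%:R : K) ->
  p.-primitive_root zeta ->
  \dim {:L} = p -> (exists h : K, generates L p h) ->
  ((exists h : K, best L A p h) <->
   (exists h : K, [/\ h \in A, generates L p h &
      exactly_one [:: prop_i A p h; prop_ii A p h; prop_iii A p (zeta - 1) h;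
                      prop_iv A p (zeta - 1) h; prop_v A p (zeta - 1) h]]))
  /\
  ((exists h : K, [/\ h \in A, generates L p h &
      exactly_one [:: prop_i A p h; prop_ii A p h; prop_iii A p (zeta - 1) h;
                      prop_iv A p (zeta - 1) h; prop_v A p (zeta - 1) h]])
   <-> defectless L A).
Proof.
move=> pp hA henA _ char0 /(maxidP hA) hp hzeta dimL [h0 gh0].
have pn0 : p%:R != 0 :> K.
  by apply/negP => e; have := char0 p; rewrite !inE pp e.
have [z0 hz] := prim_root_sub1_val hA pp hp pn0 hzeta.
have nfE : (exists h : K, [/\ h \in A, generates L p h &
      exactly_one [:: prop_i A p h; prop_ii A p h; prop_iii A p (zeta - 1) h;
                      prop_iv A p (zeta - 1) h; prop_v A p (zeta - 1) h]]) <->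
    exists h : K, [/\ h \in A, generates L p h & normal_form p A (zeta - 1) h].
  split=> -[h [hh gh nf]]; exists h; split=> //; first exact: exactly_one_normal_form.
  exact: (normal_form_exactly_one pp hA hp z0 hz).
split; split.
- move=> [h hbest]; apply/nfE.
  exact: (best_normal_form pp dimL hA henA hzeta hp pn0 erefl hbest).
- move=> /nfE[h [hh gh nf]]; exists h; split=> // g i g0 hi; apply/(vleP hA).
  apply: (normal_form_best pp hA hp z0 hz) => //; first exact: generates_neq0 gh.
  by case/andP: hi => i0 ip; rewrite i0 -(prednK (prime_gt0 pp)) ltnS.
- move=> /nfE[h [hh gh nf]].
  exact: (normal_form_defectless pp dimL hA hzeta hp pn0 erefl gh nf).
move=> dl; apply/nfE.
exact: (defectless_normal_form pp dimL hA henA hzeta hp pn0 erefl gh0 dl).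
Qed.
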